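(* Let $\mathfrak A=\overline{\bigcup_{n\in\mathbb N}\mathfrak A_n}^{\|\cdot\|_{\mathfrak A}}$ be a unital AF algebra equipped with a faithful tracial state $\tau$, where $(\mathfrak A_n)_{n\in\mathbb N}$ is a non-decreasing sequence of finite-dimensional unital C*-subalgebras of $\mathfrak A$ with $\mathfrak A_0=\mathbb C1_{\mathfrak A}$. Set $\mathcal U=(\mathfrak A_n)_{n\in\mathbb N}$ and let $(\beta(n))_{n\in\mathbb N}$ be a summable sequence of positive real numbers. For each $n\in\mathbb N$, let $E_n^\tau:\mathfrak A\to\mathfrak A_n$ be the unique $\tau$-preserving faithful conditional expectation, and let $\kappa_n>0$ be such that $\kappa_n\|a\|_{\mathfrak A}\leq\|a\|_{E_n^\tau}$ for all $a\in\mathfrak A_{n+1}$; set $\kappa=(\kappa_n)_{n\in\mathbb N}$. For each $n\in\mathbb N\setminus\{0\}$, let $$\mathsf L_{\mathcal U_n,\beta}^{\tau,\kappa}(a)=\max_{m\in\{0,1,\ldots,n-1\}}\frac{\max\left\{\|a-E_m^\tau(a)\|_{E_m^\tau},\ \|a^*-E_m^\tau(a^* )\|_{E_m^\tau}\right\}}{\kappa_m\beta(m)}$$ for all $a\in\mathfrak A_n$, and let $\mathsf L_{\mathcal U_0,\beta}^{\tau,\kappa}=0$. Then $(\mathfrak A_n,\mathsf L_{\mathcal U_n,\beta}^{\tau,\kappa})$ is a strongly Leibniz quantum compact metric space (with $(A,B,C)=(1,0,1)$) for all $n\in\mathbb N$, and there exists a seminorm $\mathsf L_{\mathcal U,\beta}^{\tau,\kappa}$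 such that $(\mathfrak A,\mathsf L_{\mathcal U,\beta}^{\tau,\kappa})$ is a strongly Leibniz quantum compact metric space (with $(A,B,C)=(1,0,1)$) and $$\mathsf{\Lambda}^\ast_{SL}((\mathfrak A_n,\mathsf L_{\mathcal U_n,\beta}^{\tau,\kappa}),(\mathfrak A,\mathsf L_{\mathcal U,\beta}^{\tau,\kappa}))\leq 4\sum_{j=n}^\infty\beta(j)$$ for all $n\in\mathbb N$, and thus $\lim_{n\to\infty}\mathsf{\Lambda}^\ast_{SL}((\mathfrak A_n,\mathsf L_{\mathcal U_n,\beta}^{\tau,\kappa}),(\mathfrak A,\mathsf L_{\mathcal U,\beta}^{\tau,\kappa}))=0$.
   Context: $\mathbb N=\{0,1,2,\dots\}$. Unital C*-subalgebras of $\mathfrak A$ contain $1_{\mathfrak A}$. For a unital C*-algebra $\mathfrak A$: $\mathfrak{sa}(\mathfrak A)$ is the set of self-adjoint elements, $\mathrm{GL}(\mathfrak A)$ the group of invertible elements, $\mathscr S(\mathfrak A)$ the state space. Conditional expectations. For a unital C*-subalgebra $\mathfrak B\subseteq\mathfrak A$, a linear map $E:\mathfrak A\to\mathfrak B$ is a conditional expectation if $E(b)=b$, $\|E(a)\|_{\mathfrak A}\le\|a\|_{\mathfrak A}$ and $E(bab')=bE(a)b'$ for all $a\in\mathfrak A$, $b,b'\in\mathfrak B$; it is faithful if $E(a^*a)=0$ implies $a=0$; it is $\tau$-preserving if $\tau\circ E=\tau$. If $E$ is faithful, the Frobenius–Rieffel norm associated to $E$ is $\|a\|_E=\sqrt{\|E(a^*a)\|_{\mathfrak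 A}}$. Quantum compact metric space with $(A,B)=(1,0)$: a pair $(\mathfrak A,\mathsf L)$ of a unital C*-algebra $\mathfrak A$ and a seminorm $\mathsf L$ defined on a dense Jordan-Lie subalgebra $\mathrm{dom}(\mathsf L)$ of $\mathfrak{sa}(\mathfrak A)$ (a real subspace closed under $(ab+ba)/2$ and $(ab-ba)/(2i)$) such that: (1) $\{a\in\mathrm{dom}(\mathsf L):\mathsf L(a)=0\}=\mathbb R 1_{\mathfrak A}$; (2) $\mathsf{mk}_{\mathsf L}(\varphi,\psi)=\sup\{|\varphi(a)-\psi(a)|:a\in\mathrm{dom}(\mathsf L),\ \mathsf L(a)\leq 1\}$ metrizes the weak* topology of $\mathscr S(\mathfrak A)$; (3) for all $a,b\in\mathrm{dom}(\mathsf L)$, $\max\{\mathsf L(\frac{ab+ba}{2}),\mathsf L(\frac{ab-ba}{2i})\}\leq \mathsf L(a)\|b\|_{\mathfrak A}+\|a\|_{\mathfrak A}\mathsf L(b)$; (4) $\{a\in\mathrm{dom}(\mathsf L):\mathsf L(a)\leq 1\}$ is closed in $\mathfrak A$. It is strongly Leibniz (with $C=1$) if for all $a\in\mathrm{dom}(\mathsf L)\cap\mathrm{GL}(\mathfrak A)$, $a^{-1}\in\mathrm{dom}(\mathsf L)$ and $\mathsf L(a^{-1})\leq\|a^{-1}\|_{\mathfrak A}^2\mathsf L(a)$. A seminorm given on all of a finite-dimensional $\mathfrak A_n$ is considered as an L-seminorm by restricting it to $\mathfrak{sa}(\mathfrak A_n)$. A quantum isometry $\pi:(\mathfrak A,\mathsf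 L_{\mathfrak A})\to(\mathfrak B,\mathsf L_{\mathfrak B})$ is a surjective *-morphism $\pi:\mathfrak A\to\mathfrak B$ with $\pi(\mathrm{dom}(\mathsf L_{\mathfrak A}))\subseteq\mathrm{dom}(\mathsf L_{\mathfrak B})$ and $\mathsf L_{\mathfrak B}(b)=\inf\{\mathsf L_{\mathfrak A}(a):a\in\mathrm{dom}(\mathsf L_{\mathfrak A}),\pi(a)=b\}$ for all $b\in\mathrm{dom}(\mathsf L_{\mathfrak B})$. A tunnel $(\mathfrak D,\mathsf L_{\mathfrak D},\pi_1,\pi_2)$ from $(\mathfrak A_1,\mathsf L_1)$ to $(\mathfrak A_2,\mathsf L_2)$ is a quantum compact metric space $(\mathfrak D,\mathsf L_{\mathfrak D})$ with quantum isometries $\pi_j:(\mathfrak D,\mathsf L_{\mathfrak D})\to(\mathfrak A_j,\mathsf L_j)$, $j=1,2$; its extent is $\chi=\max_{j\in\{1,2\}}\mathsf{Haus}_{\mathsf{mk}_{\mathsf L_{\mathfrak D}}}(\mathscr S(\mathfrak D),\{\varphi\circ\pi_j:\varphi\in\mathscr S(\mathfrak A_j)\})$ ($\mathsf{Haus}$ the Hausdorff distance). For strongly Leibniz quantum compact metric spaces ($(A,B,C)=(1,0,1)$), $\mathsf{\Lambda}^\ast_{SL}$ is the infimum of extents of tunnels between them with $(\mathfrak D,\mathsf L_{\mathfrak D})$ also strongly Leibniz ($(A,B,C)=(1,0,1)$). *)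

(* Defs.v *)
From HB Require Import structures.
From mathcomp Require Import all_boot all_order all_algebra.
From mathcomp Require Import complex.
From mathcomp Require Import all_classical all_reals all_analysis.
Set Implicit Arguments.
Unset Strict Implicit.
Unset Printing Implicit Defensive.
Import Order.TTheory GRing.Theory Num.Theory.
Import numFieldNormedType.Exports.
Local Open Scope classical_set_scope.
Local Open Scope ring_scope.
Local Open Scope complex_scope.

(* [GRing.Algebra] and [NormedModule] have no join in the library, so the norm is
   a separate real-valued operation, and its topology sits on the alias
   [normed A] below, which is a library [completeNormedModType]. *)
HB.mixin Record Algebra_isPreCStar (R : realType) (A : Type)
    & GRing.Algebra R[i] A := {
  cnorm : A -> R ;
  cnormD : forall a b : A, cnorm (a + b) <= cnorm a + cnorm b ;
  cnormZ : forall (z : R[i]) (a : A), cnorm (z *: a) = complex.Re `|z| * cnorm a ;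
  cnorm_eq0 : forall a : A, cnorm a = 0 -> a = 0 ;
  cnormM : forall a b : A, cnorm (a * b) <= cnorm a * cnorm b ;
  star : A -> A ;
  starK : involutive star ;
  starD : {morph star : a b / a + b} ;
  starZ : forall (z : R[i]) (a : A), star (z *: a) = z^* *: star a ;
  starM : forall a b : A, star (a * b) = star b * star a ;
  cnorm_star : forall a : A, cnorm (star a * a) = cnorm a ^+ 2
}.

#[short(type="preCStarType")]
HB.structure Definition PreCStar (R : realType) :=
  {A of GRing.Algebra R[i] A & Algebra_isPreCStar R A}.

Definition normed (R : realType) (A : preCStarType R) : Type := A.

Section NormTopology.
Context {R : realType} {A : preCStarType R}.

HB.instance Definition _ := GRing.Lmodule.on (normed A).

Let norm (a : normed A) : R[i] := (cnorm (a : A))%:C.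

Let ler_normD a b : norm (a + b) <= norm a + norm b.
Proof. by rewrite /norm -rmorphD lecR cnormD. Qed.

Let normrZ (z : R[i]) a : norm (z *: a) = `|z| * norm a.
Proof. by rewrite /norm cnormZ rmorphM; congr (_ * _); apply: RRe_real; exact: normr_real. Qed.

Let normr0_eq0 a : norm a = 0 -> a = 0.
Proof. by move=> /eqP; rewrite fmorph_eq0 => /eqP; exact: cnorm_eq0. Qed.

HB.instance Definition _ :=
  Lmodule_isNormed.Build R[i] (normed A) ler_normD normrZ normr0_eq0.

End NormTopology.

HB.mixin Record PreCStar_isCStar (R : realType) (A : Type)
    & PreCStar R A := {
  cauchy_normed_cvg : forall F : set_system (normed A),
    ProperFilter F -> cauchy F -> cvg F
}.

#[short(type="cstarType")]
HB.structure Definition CStar (R : realType) :=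
  {A of PreCStar R A & PreCStar_isCStar R A}.

HB.instance Definition _ (R : realType) (A : cstarType R) :=
  Uniform_isComplete.Build (normed A) (@cauchy_normed_cvg R A).

Section CStarBasics.
Context {R : realType} {A : cstarType R}.

Definition selfadjoint : set A := [set a | star a = a].

(* For [z : R[i]], [0 <= z] means that [z] is real and nonnegative. *)
Definition state_space : set (A -> R[i]) :=
  [set phi | [/\ scalar phi, forall a, 0 <= phi (star a * a) & phi 1 = 1]].

Definition tracial_state (tau : A -> R[i]) :=
  state_space tau /\ forall a b, tau (a * b) = tau (b * a).

Definition faithful (B : zmodType) (f : A -> B) :=
  forall a, f (star a * a) = 0 -> a = 0.

Definition jordan_mul (a b : A) : A := (2 : R[i])^-1 *: (a * b + b * a).
Definition lie_mul (a b : A) : A := (2 * 'i : R[i])^-1 *: (a * b - b * a).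

Definition inverse_of (a b : A) := a * b = 1 /\ b * a = 1.

Definition finite_dimensional (B : set A) :=
  exists s : seq A, (forall b, b \in s -> B b) /\
    forall b, B b -> exists c : nat -> R[i], b = \sum_(i < size s) c i *: s`_i.

End CStarBasics.

Record cstar_subalgebra (R : realType) (A : cstarType R) := CStarSubalgebra {
  subalg_set :> set A ;
  subalg1 : subalg_set 1 ;
  subalgD : forall a b, subalg_set a -> subalg_set b -> subalg_set (a + b) ;
  subalgZ : forall (z : R[i]) a, subalg_set a -> subalg_set (z *: a) ;
  subalgM : forall a b, subalg_set a -> subalg_set b -> subalg_set (a * b) ;
  subalg_star : forall a, subalg_set a -> subalg_set (star a) ;
  subalg_closedness : closed (subalg_set : set (normed A))
}.

Section SubalgebraAsCStar.
Context {R : realType} {A : cstarType R}.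
Implicit Type S : cstar_subalgebra A.

Definition subalg_pred S : pred A := fun a => `[< subalg_set S a >].

Lemma subalg_predP S : subalg_closed (subalg_pred S).
Proof.
split => [|z a b|a b]; rewrite !inE /=; first exact: subalg1.
- by move=> Sa Sb; apply: subalgD Sb; exact: subalgZ.
- exact: subalgM.
Qed.

HB.instance Definition _ S := GRing.isSubalgClosed.Build R[i] A (subalg_pred S)
  (GRing.subalg_closed_semi (subalg_predP S)).

Record subalg_type S := SubalgElt {
  subalg_val : A ;
  subalg_valP : subalg_val \in subalg_pred S
}.

Section Instances.
Variable S : cstar_subalgebra A.
Notation T := (subalg_type S).

HB.instance Definition _ := [isSub for @subalg_val S].
HB.instance Definition _ := [Choice of T by <:].
HB.instance Definition _ := [SubChoice_isSubAlgebra of T by <:].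

Let norm (a : T) : R := cnorm (subalg_val a).

Let normD a b : norm (a + b) <= norm a + norm b.
Proof. exact: cnormD. Qed.

Let normZ (z : R[i]) a : norm (z *: a) = complex.Re `|z| * norm a.
Proof. exact: cnormZ. Qed.

Let norm_eq0 a : norm a = 0 -> a = 0.
Proof. by move=> /cnorm_eq0 a0; apply: val_inj. Qed.

Let normM a b : norm (a * b) <= norm a * norm b.
Proof. exact: cnormM. Qed.

Let subalg_star_in (a : T) : star (subalg_val a) \in subalg_pred S.
Proof. by apply/asboolP; apply: subalg_star; exact/asboolP/(subalg_valP a). Qed.

Let sstar (a : T) : T := SubalgElt (subalg_star_in a).

Let sstarK : involutive sstar.
Proof. by move=> a; apply: val_inj; exact: starK. Qed.

Let sstarD : {morph sstar : a b / a + b}.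
Proof. by move=> a b; apply: val_inj; exact: starD. Qed.

Let sstarZ (z : R[i]) a : sstar (z *: a) = z^* *: sstar a.
Proof. by apply: val_inj; exact: starZ. Qed.

Let sstarM a b : sstar (a * b) = sstar b * sstar a.
Proof. by apply: val_inj; exact: starM. Qed.

Let norm_sstar a : norm (sstar a * a) = norm a ^+ 2.
Proof. exact: cnorm_star. Qed.

HB.instance Definition _ := Algebra_isPreCStar.Build R T
  normD normZ norm_eq0 normM sstarK sstarD sstarZ sstarM norm_sstar.

Let subalg_complete (F : set_system (normed T)) :
  ProperFilter F -> cauchy F -> cvg F.
Proof.
move=> FF cF.
pose v (a : normed T) : normed A := subalg_val (a : T).
have cG : cauchy (v @ F).
  apply/cauchy_ballP => e e0; move/cauchy_ballP: cF => /(_ e e0).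
  rewrite !near2E /= => -[[P Q] [/= FP FQ] PQ].
  exists (v @` P, v @` Q) => /=.
    by split => /=; [apply: filterS FP|apply: filterS FQ] => x Px; exists x.
  by move=> [_ _] /= [[x Px <-] [y Qy <-]]; exact: (PQ (x, y)).
have /cvg_ex[l Gl] : cvg (v @ F) by exact: cauchy_normed_cvg.
have Sl : subalg_set S l.
  apply: (@closed_cvg _ _ F FF v (subalg_set S : set (normed A))) => //.
  - exact: subalg_closedness.
  - by apply: nearW => a; apply/asboolP/(subalg_valP a).
apply/cvg_ex; exists (SubalgElt (introT (asboolP _) Sl) : normed T).
apply/cvgrPdist_lt => e e0.
by move/cvgrPdist_lt: Gl => /(_ e e0).
Qed.

HB.instance Definition _ := PreCStar_isCStar.Build R T subalg_complete.

End Instances.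
End SubalgebraAsCStar.

Section ConditionalExpectation.
Context {R : realType} {A : cstarType R}.

Definition conditional_expectation (B : cstar_subalgebra A) (E : A -> A) :=
  [/\ linear E, (forall a, subalg_set B (E a)), (forall b, subalg_set B b -> E b = b),
      (forall a, cnorm (E a) <= cnorm a)
    & forall a b b', subalg_set B b -> subalg_set B b' -> E (b * a * b') = b * E a * b'].

Definition frobenius_rieffel_norm (E : A -> A) (a : A) : R :=
  Num.sqrt (cnorm (E (star a * a))).

End ConditionalExpectation.

Definition metrizes (R : realType) (T : topologicalType) (S : set T)
    (d : T -> T -> \bar R) :=
  [/\ forall x y, S x -> S y -> d x y \is a fin_num,
      forall x y, S x -> S y -> (d x y = 0%E <-> x = y),
      forall x y, S x -> S y -> d x y = d y x,
      forall x y z, S x -> S y -> S z -> (d x z <= d x y + d y z)%E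
    & forall U : set T, U `<=` S ->
        (exists2 V : set T, open V & U = S `&` V) <->
        (forall x, U x -> exists2 e : R, 0 < e &
           forall y, S y -> (d x y < e%:E)%E -> U y)].

Definition hausdorff_distance (R : realType) (T : Type) (d : T -> T -> \bar R)
    (P Q : set T) : \bar R :=
  Order.max
    (ereal_sup [set ereal_inf [set d x y | y in Q] | x in P])
    (ereal_sup [set ereal_inf [set d x y | x in P] | y in Q]).

(* The seminorm is partial: [qlip] is only meaningful on [qdom]. *)
Record quantum_pair (R : realType) := QuantumPair {
  qalg :> cstarType R ;
  qdom : set qalg ;
  qlip : qalg -> R
}.

Section QuantumCompactMetricSpaces.
Context {R : realType}.
Implicit Types X Y D : quantum_pair R.

Definition jordan_lie_subalgebra (A : cstarType R) (V : set A) :=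
  [/\ V `<=` selfadjoint, V 0,
      (forall a b, V a -> V b -> V (a + b)),
      (forall (t : R) a, V a -> V (t%:C *: a))
    & forall a b, V a -> V b -> V (jordan_mul a b) /\ V (lie_mul a b)].

Definition seminorm_on (A : cstarType R) (V : set A) (L : A -> R) :=
  [/\ (forall a, V a -> 0 <= L a),
      (forall a b, V a -> V b -> L (a + b) <= L a + L b)
    & forall (t : R) a, V a -> L (t%:C *: a) = `|t| * L a].

Definition monge_kantorovich X (phi psi : X -> R[i]) : \bar R :=
  ereal_sup [set (complex.Re `|phi a - psi a|)%:E
            | a in [set a | qdom a /\ @qlip R X a <= 1]].

(* The weak* topology is the topology of pointwise convergence on states. *)
Definition quantum_compact_metric_space X :=
  [/\ [/\ jordan_lie_subalgebra (@qdom R X),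
      (selfadjoint : set (normed X)) `<=` closure (@qdom R X : set (normed X))
      & seminorm_on (@qdom R X) (@qlip R X)],
      [set a : X | qdom a /\ qlip a = 0] = [set t%:C *: (1 : X) | t in [set: R]],
      metrizes (state_space : set {ptws X -> (R[i])^o}) (@monge_kantorovich X),
      (forall a b : X, qdom a -> qdom b ->
         Num.max (qlip (jordan_mul a b)) (qlip (lie_mul a b))
           <= qlip a * cnorm b + cnorm a * qlip b)
    & closed ([set a | qdom a /\ qlip a <= 1] : set (normed X))].

Definition strongly_leibniz X :=
  forall a b : X, qdom a -> inverse_of a b ->
    qdom b /\ qlip b <= cnorm b ^+ 2 * qlip a.

Definition strongly_leibniz_qcms X :=
  quantum_compact_metric_space X /\ strongly_leibniz X.

Definition star_morphism (A B : cstarType R) (f : A -> B) :=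
  [/\ linear f, {morph f : a b / a * b} & {morph f : a / star a}].

Definition quantum_isometry X Y (f : X -> Y) :=
  [/\ star_morphism f, (forall b, exists a, f a = b),
      (forall a, qdom a -> qdom (f a))
    & forall b, qdom b ->
        (qlip b)%:E =
        ereal_inf [set (qlip a)%:E | a in [set a : X | qdom a /\ f a = b]]].

Definition tunnel X1 X2 D (p1 : D -> X1) (p2 : D -> X2) :=
  [/\ quantum_compact_metric_space D, quantum_isometry p1
    & quantum_isometry p2].

Definition tunnel_extent X1 X2 D (p1 : D -> X1) (p2 : D -> X2) : \bar R :=
  Order.max
    (hausdorff_distance (@monge_kantorovich D) state_space
       [set phi \o p1 | phi in state_space])
    (hausdorff_distance (@monge_kantorovich D) state_space
       [set phi \o p2 | phi in state_space]).

(* Value [+oo] if there is no such tunnel. *)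
Definition dual_propinquity_SL X1 X2 : \bar R :=
  ereal_inf [set r | exists D (p1 : D -> X1) (p2 : D -> X2),
    [/\ tunnel p1 p2, strongly_leibniz D & r = tunnel_extent p1 p2]].

End QuantumCompactMetricSpaces.

Section FrobeniusRieffelSpaces.
Context {R : realType} {A : cstarType R}.
Variables (E : nat -> A -> A) (kappa beta : nat -> R).

(* An empty maximum is [0], so that this is [0] for [n = 0]. *)
Definition frobenius_rieffel_lip (n : nat) (a : A) : R :=
  \big[Num.max/0]_(m < n)
    (Num.max (frobenius_rieffel_norm (E m) (a - E m a))
             (frobenius_rieffel_norm (E m) (star a - E m (star a)))
     / (kappa m * beta m)).

Definition frobenius_rieffel_space (U : nat -> cstar_subalgebra A) (n : nat) :
    quantum_pair R :=
  @QuantumPair R (subalg_type (U n)) selfadjoint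
    (fun a => frobenius_rieffel_lip n (subalg_val a)).

End FrobeniusRieffelSpaces.

(* Main.v *)
Require Import Defs.
From HB Require Import structures.
From mathcomp Require Import all_boot all_order all_algebra.
From mathcomp Require Import complex ring lra.
From mathcomp Require Import all_classical all_reals all_analysis.
Set Implicit Arguments.
Unset Strict Implicit.
Unset Printing Implicit Defensive.
Import Order.TTheory GRing.Theory Num.Theory.
Import numFieldNormedType.Exports.
Local Open Scope classical_set_scope.
Local Open Scope ring_scope.
Local Open Scope complex_scope.

(** The trace gives the Hilbert norm [|a|_tau = sqrt (tau (a^* a))], for which [E_m]
    is the orthogonal projection onto [U m].  The Frobenius-Rieffel norm of [a] is
    the norm of left multiplication by [a] from [U m] to [A] for [|.|_tau], so that
    [||a - E_m a||_{E_m}] is the norm of [(1 - E_m) a E_m]: it is controlled by the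
    commutator of [a] with [E_m], whence the strong Leibniz property.  On all of [A]
    take the supremum [L] over [m] of the weighted seminorms; it restricts to the given
    seminorm on [U n].  Since [E_m E_n = E_m] for [m <= n], [L (E_n a) <= L a], and
    telescoping gives [||a - E_n a|| <= L a * s_n] with [s_n] the tail of [beta] from
    [n].  This yields total boundedness, and makes
    [(b, a) |-> max (L b) (L a) (||b - a|| / s_n)] on the direct sum of [U n] and [A]
    a tunnel of extent at most [s_n]: a state [mu] of the sum is close to
    [b |-> mu (b, b)] and to [a |-> mu (E_n a, a)]. *)

(** * C*-norm, square roots and positive functionals *)

Import Normc.

(** No spectral theory is used. The one analytic fact about order is that [1 - x] is the square of a
    self-adjoint element when [x] is self-adjoint of norm below 1; it bounds a positive functional
    by its value at 1, and this bound replaces functional calculus. That the C*-norm on [U m] is the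
    operator norm for the trace rests on finite dimension: comparable norms become equal through the
    C*-identity on powers [h ^ (2^j)]. Two points are delicate. The constant for inverses is 1 only
    because the two pieces of the commutator of [a] and [E_m] act on orthogonal components and have
    orthogonal values, so that Pythagoras replaces the triangle inequality. And [a |-> (E_n a, a)]
    is not multiplicative, so that [a |-> mu (E_n a, a)] is a state only after positive functionals
    on [U n] are shown to be nonnegative at [E_n (a^* a)]. The spaces on [U n], on [A] and on their
    direct sum are three instances of one statement about suprema of strongly Leibniz seminorms. *)

Section ComplexParts.
Context {R : rcfType}.
Implicit Types x y : R[i].

Lemma ReD x y : complex.Re (x + y) = complex.Re x + complex.Re y.
Proof. by case: x; case: y. Qed.

Lemma ReN x : complex.Re (- x) = - complex.Re x.
Proof. by case: x. Qed.

Lemma ReZ (t : R) x : complex.Re (t%:C * x) = t * complex.Re x.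
Proof. by case: x => u v /=; rewrite mul0r subr0. Qed.

Lemma Re_ge0 x : 0 <= x -> 0 <= complex.Re x.
Proof. by rewrite lecE => /andP[]. Qed.

End ComplexParts.

Section NormAndInvolution.
Context {R : realType} {A : preCStarType R}.
Implicit Types (a b x y : A) (z : R[i]).

Lemma cnormZc z a : cnorm (z *: a) = normc z * cnorm a.
Proof. exact: cnormZ. Qed.

Lemma normc_real (t : R) : normc t%:C = `|t|.
Proof. by rewrite /normc /= expr0n /= addr0 sqrtr_sqr. Qed.

Lemma normc_ge0 z : 0 <= normc z.
Proof. by case: z => u v; exact: sqrtr_ge0. Qed.

Lemma cnorm0 : cnorm (0 : A) = 0.
Proof. by rewrite -(scale0r 0) cnormZc normc0 mul0r. Qed.

Lemma cnormN a : cnorm (- a) = cnorm a.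
Proof. by rewrite -scaleN1r cnormZc normcN normc1 mul1r. Qed.

Lemma cnorm_ge0 a : 0 <= cnorm a.
Proof. by have := cnormD a (- a); rewrite subrr cnorm0 cnormN -mulr2n pmulrn_lge0. Qed.

Lemma cnormB a b : cnorm (a - b) <= cnorm a + cnorm b.
Proof. by rewrite -(cnormN b) cnormD. Qed.

Lemma cnorm_distC a b : cnorm (a - b) = cnorm (b - a).
Proof. by rewrite -cnormN opprB. Qed.

Lemma cnorm_le_eq0 a : (forall e : R, 0 < e -> cnorm a <= e) -> a = 0.
Proof.
move=> ae; apply: cnorm_eq0; apply/eqP; rewrite eq_le cnorm_ge0 andbT.
by apply/ler_addgt0Pr => e e0; rewrite add0r ae.
Qed.

Lemma starZc z a : star (z *: a) = z^*%C *: star a.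
Proof. exact: starZ. Qed.

Lemma star0 : star 0 = 0 :> A.
Proof. by rewrite -(scale0r (0 : A)) starZc conjc0 !scale0r. Qed.

Lemma starN a : star (- a) = - star a.
Proof. by rewrite -scaleN1r starZc rmorphN rmorph1 scaleN1r. Qed.

Lemma starB a b : star (a - b) = star a - star b.
Proof. by rewrite starD starN. Qed.

Lemma star1 : star 1 = 1 :> A.
Proof. by have := starM (star 1) (1 : A); rewrite !mulr1 starK mulr1. Qed.

Lemma starZR (t : R) a : star (t%:C *: a) = t%:C *: star a.
Proof. by rewrite starZc conjc_real. Qed.

Lemma cnorm_starE a : cnorm (star a) = cnorm a.
Proof.
have H b : cnorm b <= cnorm (star b).
  have [->|b0] := eqVneq b 0; first by rewrite star0.
  have b_gt0 : 0 < cnorm b.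
    by rewrite lt0r cnorm_ge0 andbT; apply: contra b0 => /eqP/cnorm_eq0 ->.
  by rewrite -(ler_pM2r b_gt0) -expr2 -cnorm_star cnormM.
by apply/eqP; rewrite eq_le H andbT -{2}(starK a) H.
Qed.

Lemma cnorm1 : cnorm (1 : A) = 1.
Proof.
have n1 : cnorm (1 : A) != 0.
  by apply/eqP => /cnorm_eq0/eqP; rewrite oner_eq0.
by apply: (mulfI n1); rewrite mulr1 -expr2 -cnorm_star star1 mulr1.
Qed.

Lemma cnormZR (t : R) a : cnorm (t%:C *: a) = `|t| * cnorm a.
Proof. by rewrite cnormZc normc_real. Qed.

Lemma cnorm_sum (I : Type) (r : seq I) (F : I -> A) :
  cnorm (\sum_(i <- r) F i) <= \sum_(i <- r) cnorm (F i).
Proof.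
elim/big_ind2: _ => [|u s v t us vt|//]; first by rewrite cnorm0.
by rewrite (le_trans (cnormD _ _))// lerD.
Qed.

(** Balls of [normed A] have radii in [R[i]]; here and in [closureP] they are traded for real
    radii. *)
Lemma closedP (S : set A) :
  (forall a, (forall e : R, 0 < e -> exists2 b, S b & cnorm (a - b) < e) -> S a) ->
  closed (S : set (normed A)).
Proof.
move=> SP a cla; apply: SP => e e0.
have : nbhs (a : normed A) (ball (a : normed A) e%:C).
  by apply: nbhsx_ballx; rewrite ltcR.
move=> /cla [b [Sb]]; rewrite -ball_normE /= => ab; exists b => //.
by rewrite -ltcR.
Qed.

Lemma closureP (S : set A) a : closure (S : set (normed A)) a <->
  forall e : R, 0 < e -> exists2 b, S b & cnorm (a - b) < e.
Proof.
split=> [cla e e0|SP B].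
  have : nbhs (a : normed A) (ball (a : normed A) e%:C).
    by apply: nbhsx_ballx; rewrite ltcR.
  move=> /cla [b [Sb]]; rewrite -ball_normE /= => ab; exists b => //.
  by rewrite -ltcR.
rewrite -nbhs_ballE => -[e /= e0 eB].
have [|b Sb ab] := SP (complex.Re e); first by move: e0; rewrite ltcE => /andP[].
exists b; split => //; apply: eB; rewrite -ball_normE /=.
by rewrite -(RRe_real (gtr0_real e0)) ltcR.
Qed.

End NormAndInvolution.

Section Completeness.
Context {R : realType} {A : cstarType R}.

Lemma cnorm_complete (u : nat -> A) :
  (forall e : R, 0 < e -> exists N, forall k, cnorm (u (k + N)%N - u N) < e) ->
  exists l, forall e : R, 0 < e -> exists N,
    forall k, (N <= k)%N -> cnorm (l - u k) < e.
Proof.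
move=> cu; pose v (n : nat) : normed A := u n.
have : cvg (v n @[n --> \oo]).
  apply/cauchy_cvgP/cauchy_exP => e e0.
  have [|N uN] := cu (complex.Re e); first by move: e0; rewrite ltcE => /andP[].
  exists (v N); exists N => // k /= /subnK <-; rewrite -ball_normE /=.
  by rewrite -(RRe_real (gtr0_real e0)) ltcR cnorm_distC.
move=> /cvg_ex[l ul]; exists l => e e0.
have e0' : 0 < e%:C by rewrite ltcR.
move/cvgrPdist_lt: ul => /(_ _ e0')[N _ Nu]; exists N => k /Nu /=.
by rewrite ltcR.
Qed.

(* The square root is [1 - y], where [y] is the fixed point of the contraction
   [y |-> (x + y ^+ 2) / 2] of the ball of radius [cnorm x]. *)
Lemma sqrt_one_sub (x : A) : star x = x -> cnorm x < 1 ->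
  exists2 y, star y = y & 1 - x = y * y.
Proof.
set q := cnorm x => sx q1.
have q0 : 0 <= q := cnorm_ge0 x.
pose f (y : A) := (2^-1 : R)%:C *: (x + y * y).
have half2 : `|2^-1 : R| = 2^-1 by rewrite ger0_norm.
have f_lip c y z : cnorm y <= c -> cnorm z <= c ->
    cnorm (f y - f z) <= c * cnorm (y - z).
  move=> yc zc; rewrite /f -scalerBr cnormZR half2 opprD addrACA subrr add0r.
  rewrite (_ : y * y - z * z = y * (y - z) + (y - z) * z); last first.
    by rewrite mulrBr mulrBl addrA subrK.
  have : cnorm (y * (y - z) + (y - z) * z) <= c * cnorm (y - z) + cnorm (y - z) * c.
    rewrite (le_trans (cnormD _ _))// lerD// (le_trans (cnormM _ _))//.
      by rewrite ler_wpM2r// cnorm_ge0.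
    by rewrite ler_wpM2l// cnorm_ge0.
  by move=> H; lra.
pose u n := iter n f 0.
have uq n : cnorm (u n) <= q.
  elim: n => [|n IHn]; first by rewrite cnorm0.
  rewrite /= -/(u n) /f cnormZR half2.
  have : cnorm (x + u n * u n) <= q + q * q.
    rewrite (le_trans (cnormD _ _))// lerD2l (le_trans (cnormM _ _))//.
    by rewrite ler_pM// cnorm_ge0.
  by move=> H; nra.
(* All iterates lie within [q <= 1] of [u 0 = 0], and [f] contracts by the factor [q] on the ball of
   radius [q]. *)
have udist k n : cnorm (u (k + n)%N - u n) <= q ^+ n.
  elim: n => [|n IHn].
    by rewrite addn0 expr0 subr0 (le_trans (uq k)) ?ltW.
  by rewrite addnS /= (le_trans (f_lip q _ _ _ _))// exprS ler_wpM2l.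
have [e e0|l ul] := @cnorm_complete u.
  have /cvgrPdist_lt/(_ e e0)[N _ qN] : q ^+ n @[n --> \oo] --> 0.
    by apply: cvg_expr; rewrite ger0_norm.
  exists N => k; rewrite (le_lt_trans (udist k N))//.
  by have := qN N (leqnn N); rewrite /= sub0r normrN ger0_norm ?exprn_ge0.
have su n : star (u n) = u n.
  elim: n => [|n IHn]; first exact: star0.
  by rewrite /= -/(u n) /f starZR starD starM IHn sx.
have sl : star l = l.
  apply/eqP; rewrite -subr_eq0; apply/eqP/cnorm_le_eq0 => e e0.
  have [|N uN] := ul (e / 2); first by rewrite divr_gt0.
  rewrite -(subrKA (u N)) -{1}(su N) -starB (le_trans (cnormD _ _))//.
  by rewrite cnorm_starE (cnorm_distC _ l) (splitr e) lerD// ltW// uN.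
have fl : l = f l.
  apply/eqP; rewrite -subr_eq0; apply/eqP/cnorm_le_eq0 => e e0.
  (* [2 + cnorm l] adds the factor 1 of [l - u N.+1] and the Lipschitz constant [1 + cnorm l] of [f]
     on a ball containing both [u N] and [l]. *)
  have c0 : 0 < 2 + cnorm l by rewrite ltr_wpDr// cnorm_ge0.
  have [|N uN] := ul (e / (2 + cnorm l)); first by rewrite divr_gt0.
  rewrite -(subrKA (u N.+1)) (le_trans (cnormD _ _))//.
  have H1 := ltW (uN N.+1 (leqnSn N)); have H2 := ltW (uN N (leqnn N)).
  have H3 : cnorm (u N.+1 - f l) <= (1 + cnorm l) * cnorm (u N - l).
    apply: f_lip; rewrite ?lerDr// (le_trans (uq N))// ler_wpDr ?cnorm_ge0//.
    exact: ltW.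
  rewrite (cnorm_distC _ l) in H3.
  rewrite (le_trans (lerD H1 (le_trans H3 (ler_wpM2l _ H2))))//.
    by rewrite addr_ge0// cnorm_ge0.
  by rewrite -[X in X + _]mul1r -mulrDl addrA mulrC mulfVK ?gt_eqF.
exists (1 - l); first by rewrite starB star1 sl.
have -> : x = l + l - l * l.
  rewrite -[l + l]mulr2n -scaler_nat {1}fl /f scalerA.
  by rewrite -(rmorph_nat (real_complex R)) -rmorphM/= divff// scale1r addrK.
by rewrite mulrBl mul1r mulrBr mulr1 !opprB addrA opprD -!addrA; congr (_ + _); rewrite addrCA.
Qed.

End Completeness.

Section PositiveFunctionals.
Context {R : realType} {A : cstarType R}.
Variable f : {scalar A}.
Hypothesis f_ge0 : forall a, 0 <= f (star a * a).
Implicit Types a b : A.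

(** Positivity at [1 + z *: a] makes [z * f a + conj z * f (star a)] real for every [z]; the cases
    [z = 1] and [z = i] determine [f (star a)]. *)
Lemma positive_star a : f (star a) = (f a)^*%C.
Proof.
have H (z : R[i]) : complex.Im (z * f a + z^*%C * f (star a)) = 0.
  have /ger0_Im := f_ge0 (1 + z *: a).
  rewrite starD star1 starZc mulrDl !mulrDr !mul1r mulr1 -scalerAl -!scalerAr scalerA.
  rewrite !linearD !linearZ /=.
  have /ger0_Im := f_ge0 1; rewrite star1 mul1r => I1.
  have /ger0_Im I2 := f_ge0 a.
  rewrite I1.
  have -> : complex.Im (z^*%C * z * f (star a * a)) = 0.
    by rewrite mulrC mulrA; move: (f _) I2 z => [s t] /= -> [v w] /=; ring.
  by rewrite addr0 add0r.
have := H 1; have := H 'i%C.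
by case: (f a) => s t; case: (f (star a)) => v w /= H1 H2; congr (_ +i* _)%C; lra.
Qed.

(** For [c > cnorm a] the element [1 - a / c] is the square of a self-adjoint element, so that [f]
    is nonnegative there; then [c] decreases to [cnorm a]. *)
Lemma positive_Re_le a : star a = a -> complex.Re (f a) <= complex.Re (f 1) * cnorm a.
Proof.
move=> sa; have f1 : 0 <= complex.Re (f 1).
  by have := f_ge0 1; rewrite star1 mul1r lecE => /andP[].
apply/ler_addgt0Pr => e e0.
(* This choice gives [d * Re (f 1) <= e], also when [f 1 = 0]. *)
pose d := e / (1 + complex.Re (f 1)).
have d0 : 0 < d by rewrite divr_gt0// ltr_wpDr.
pose c := cnorm a + d.
have c0 : 0 < c by rewrite ltr_wpDl ?cnorm_ge0.
have [|| y sy ya] := @sqrt_one_sub _ _ (c^-1%:C *: a).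
- by rewrite starZR sa.
- rewrite cnormZR ger0_norm ?invr_ge0 ?(ltW c0)//.
  by rewrite mulrC ltr_pdivrMr// mul1r ltrDl.
have : 0 <= complex.Re (f (1 - c^-1%:C *: a)).
  by rewrite ya -{1}sy; have := f_ge0 y; rewrite lecE => /andP[].
rewrite linearB linearZ /= ReD ReN ReZ.
rewrite subr_ge0 mulrC ler_pdivrMr// => /le_trans; apply.
rewrite mulrDr lerD2l /d mulrC -mulrA ler_piMr ?(ltW e0)//.
by rewrite mulrC ler_pdivrMr ?mul1r ?lerDr// ltr_wpDr.
Qed.

(** Discriminant argument: positivity at [a + (t * conj g) *: b] gives a nonnegative quadratic
    polynomial in the real number [t], evaluated at [t = - 1 / r]. For [r = 0] it is affine in [t],
    hence constant. *)
Lemma positive_Cauchy_Schwarz a b : normc (f (star a * b)) ^+ 2 <=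
  complex.Re (f (star a * a)) * complex.Re (f (star b * b)).
Proof.
set g := f (star a * b); set p := complex.Re (f (star a * a)).
set r := complex.Re (f (star b * b)).
have p0 : 0 <= p by have := f_ge0 a; rewrite lecE => /andP[].
have r0 : 0 <= r by have := f_ge0 b; rewrite lecE => /andP[].
have H (t : R) : 0 <= p + t * normc g ^+ 2 *+ 2 + t ^+ 2 * normc g ^+ 2 * r.
  have h := f_ge0 (a + (t%:C * g^*%C) *: b).
  rewrite starD starZc mulrDl !mulrDr -!scalerAl -!scalerAr scalerA in h.
  rewrite !linearD !linearZ /= -/g in h.
  have fba : f (star b * a) = g^*%C by rewrite /g -positive_star starM starK.
  have {h} := Re_ge0 h; rewrite fba !ReD -/p /=.
  have : complex.Im (f (star b * b)) = 0 by apply/ger0_Im.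
  rewrite /r; case: (f (star b * b)) => r1 r2 /= ->.
  rewrite {fba}; case: g => g1 g2 /=.
  have -> := sqr_sqrtr (addr_ge0 (sqr_ge0 g1) (sqr_ge0 g2)).
  by move=> H; lra.
have [req0|r_neq0] := eqVneq r 0.
  rewrite req0 mulr0 leNgt; apply/negP; move: H.
  move: (normc g ^+ 2) => N H N0.
  (* With [r = 0] the polynomial takes the value [-1] at this point. *)
  have := H (- (p + 1) / (2 * N)).
  have -> : - (p + 1) / (2 * N) * N *+ 2 = - (p + 1).
    by field; rewrite gt_eqF.
  by rewrite req0; lra.
have r_gt0 : 0 < r by rewrite lt0r r_neq0.
have := H (- r^-1); move: (normc g ^+ 2) => N {}H.
have {}H : 0 <= p - N / r.
  rewrite (_ : p - N / r = p + - r^-1 * N *+ 2 + (- r^-1) ^+ 2 * N * r)//.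
  by field.
by rewrite -ler_pdivrMr// -subr_ge0.
Qed.

Lemma positive_normc_le a : normc (f a) <= complex.Re (f 1) * cnorm a.
Proof.
have f1 : 0 <= complex.Re (f 1).
  by have := f_ge0 1; rewrite star1 mul1r lecE => /andP[].
rewrite -(ler_pXn2r (_ : 0 < 2)%N)// ?nnegrE ?mulr_ge0 ?cnorm_ge0 ?normc_ge0//.
rewrite -{1}(mul1r a) -{1}star1 (le_trans (positive_Cauchy_Schwarz _ _))//.
rewrite star1 mul1r exprMn expr2 -mulrA ler_wpM2l// -cnorm_star.
by rewrite positive_Re_le// starM starK.
Qed.

End PositiveFunctionals.

(** * The Monge-Kantorovich metric *)

Section States.
Context {R : realType} {A : cstarType R}.

Lemma state_scalar (phi : A -> R[i]) : state_space phi ->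
  exists2 f : {scalar A}, f = phi :> (A -> R[i]) &
    (forall a, 0 <= f (star a * a)) /\ f 1 = 1.
Proof.
case=> lin pos one.
pose f : {scalar A} := HB.pack phi (GRing.isLinear.Build R[i] A R[i] _ phi lin).
by exists f.
Qed.

Lemma state_normc_le (phi : A -> R[i]) a : state_space phi ->
  normc (phi a) <= cnorm a.
Proof.
case/state_scalar => f <- [f0 f1].
by rewrite (le_trans (positive_normc_le f0 a))// f1 mul1r.
Qed.

Lemma stateB (phi : A -> R[i]) a b : state_space phi -> phi (a - b) = phi a - phi b.
Proof. by case/state_scalar => f <- _; rewrite linearB. Qed.

Lemma stateD (phi : A -> R[i]) a b : state_space phi -> phi (a + b) = phi a + phi b.
Proof. by case/state_scalar => f <- _; rewrite linearD. Qed.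

Lemma stateZ (phi : A -> R[i]) z a : state_space phi -> phi (z *: a) = z * phi a.
Proof. by case/state_scalar => f <- _; rewrite linearZ. Qed.

End States.

Section PointwiseTopology.

Lemma ptws_nbhs_preimage (T : eqType) (Y : topologicalType) (f : {ptws T -> Y})
    t (B : set Y) :
  nbhs (f t) B -> nbhs f [set g : {ptws T -> Y} | B (g t)].
Proof. exact: (@proj_continuous T (fun _ => Y) t f). Qed.

Lemma ptws_cvgP (T : eqType) (Y : topologicalType) (F : set_system {ptws T -> Y})
    (f : {ptws T -> Y}) : Filter F ->
  (forall t (B : set Y), nbhs (f t) B -> F [set g : {ptws T -> Y} | B (g t)]) ->
  F --> f.
Proof.
move=> FF Ff; apply/cvg_sup => t; apply/cvg_image.
  by apply/seteqP; split => // z _; exists (fun=> z).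
move=> B /= /Ff FB; exists [set g : {ptws T -> Y} | B (g t)] => //.
by apply/seteqP; split => [_ [g ? <-]//|z Bz]; exists (fun=> z).
Qed.

Context {R : realType} {T : choiceType}.
Implicit Types f g : {ptws T -> (R[i])^o}.

Lemma nbhs_normcP (x : (R[i])^o) (B : set (R[i])^o) : nbhs x B <->
  exists2 e : R, 0 < e & [set y | normc (x - y) < e] `<=` B.
Proof.
split=> [/nbhs_ballP[e /= e0 eB]|[e e0 eB]]; last first.
  apply/nbhs_ballP; exists e%:C; first by rewrite /= ltcR.
  by move=> y; rewrite -ball_normE /ball_ /= ltcR; exact: eB.
exists (complex.Re e); first by move: e0; rewrite ltcE => /andP[].
move=> y /= xy; apply: eB; rewrite -ball_normE /ball_ /=.
by rewrite -(RRe_real (gtr0_real e0)) ltcR.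
Qed.

Lemma ptws_nbhs_normc f t (e : R) : 0 < e ->
  nbhs f [set g : {ptws T -> (R[i])^o} | normc (f t - g t) < e].
Proof.
move=> e0; apply: (ptws_nbhs_preimage (B := [set y | normc (f t - y) < e])).
by apply/nbhs_normcP; exists e.
Qed.

Lemma ptws_nbhs_sum f (s : seq T) (e : R) : 0 < e ->
  nbhs f [set g : {ptws T -> (R[i])^o} | \sum_(t <- s) normc (f t - g t) < e].
Proof.
elim: s e => [|t s IHs] e e0.
  by apply: filterE => g /=; rewrite big_nil.
have e20 : 0 < e / 2 by rewrite divr_gt0.
apply: filterS (filterI (ptws_nbhs_normc f t e20) (IHs _ e20)) => g [/= H1 H2].
by rewrite big_cons (splitr e) ltrD.
Qed.

Lemma ptws_cvg_normc (F : set_system {ptws T -> (R[i])^o}) f : Filter F ->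
  (forall t (e : R), 0 < e ->
     F [set g : {ptws T -> (R[i])^o} | normc (f t - g t) < e]) ->
  F --> f.
Proof.
move=> FF Ff; apply: ptws_cvgP => t B /nbhs_normcP[e /(Ff t) Fe eB].
by apply: filterS Fe => g; exact: eB.
Qed.

End PointwiseTopology.

Section Metrization.
Context {R : realType} (X : quantum_pair R).
Implicit Types (a : X) (phi psi chi : X -> R[i]).
Hypothesis dom_jl : jordan_lie_subalgebra (@qdom R X).
Hypothesis dom_dense : forall a, selfadjoint a -> forall e : R, 0 < e ->
  exists2 b, qdom b & cnorm (a - b) < e.
Hypothesis lip_seminorm : seminorm_on (@qdom R X) (@qlip R X).
(* Total boundedness of the Lipschitz ball modulo scalars, in dual form. *)
Hypothesis lip_approx : forall e : R, 0 < e -> exists (s : seq X) (C : R),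
  0 <= C /\ forall a phi psi, qdom a -> qlip a <= 1 ->
    state_space phi -> state_space psi ->
    normc (phi a - psi a) <= e + C * \sum_(x <- s) normc (phi x - psi x).

Let mk := @monge_kantorovich R X.

Lemma mk_ub a phi psi : qdom a -> qlip a <= 1 ->
  ((normc (phi a - psi a))%:E <= mk phi psi)%E.
Proof. by move=> da La; apply: ereal_sup_ubound; exists a. Qed.

Lemma mk_le phi psi (r : \bar R) :
  (forall a, qdom a -> qlip a <= 1 -> ((normc (phi a - psi a))%:E <= r)%E) ->
  (mk phi psi <= r)%E.
Proof. by move=> H; apply: ge_ereal_sup => _ [a [da La] <-]; exact: H. Qed.

Lemma mk_ge0 phi psi : (0 <= mk phi psi)%E.
Proof.
have [_ d0 _ _ _] := dom_jl; have [_ _ LZ] := lip_seminorm.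
have L0 : qlip (0 : X) = 0.
  by rewrite -(scaler0 _ (0%:C : R[i])) LZ// normr0 mul0r.
apply: le_trans (mk_ub phi psi d0 _); last by rewrite L0.
by rewrite lee_fin normc_ge0.
Qed.

Lemma mk_fin phi psi : state_space phi -> state_space psi ->
  mk phi psi \is a fin_num.
Proof.
move=> Sphi Spsi; have [s [C [C0 H]]] := lip_approx ltr01.
rewrite ge0_fin_numE ?mk_ge0//; apply: le_lt_trans (ltry _).
by apply: mk_le => a da La; rewrite lee_fin; exact: H.
Qed.

Lemma mkC phi psi : mk phi psi = mk psi phi.
Proof.
suff H f g : (mk f g <= mk g f)%E by apply/eqP; rewrite eq_le !H.
apply: mk_le => a da La; rewrite -normcN opprB; exact: mk_ub.
Qed.

Lemma mk_triangle phi psi chi : (mk phi chi <= mk phi psi + mk psi chi)%E.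
Proof.
apply: mk_le => a da La.
rewrite -(subrKA (psi a)); apply: le_trans (leeD (mk_ub _ _ da La) (mk_ub _ _ da La)).
by rewrite -EFinD lee_fin le_normcD.
Qed.

(** Rescaling by [qlip a + 1] puts [a] in the Lipschitz ball even when [qlip a = 0]. *)
Lemma mk_dom_control phi psi (r : R) a : state_space phi -> state_space psi ->
  (mk phi psi <= r%:E)%E -> qdom a -> normc (phi a - psi a) <= (qlip a + 1) * r.
Proof.
move=> Sphi Spsi mr da; have [_ _ _ dZ _] := dom_jl.
have [L0 _ LZ] := lip_seminorm.
have K0 : 0 < qlip a + 1 by rewrite ltr_wpDl// L0.
have : ((normc (phi ((qlip a + 1)^-1%:C *: a) - psi ((qlip a + 1)^-1%:C *: a)))%:E
        <= r%:E)%E.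
  apply: le_trans mr; apply: mk_ub; first exact: dZ.
  rewrite LZ// ger0_norm ?invr_ge0 ?(ltW K0)// mulrC ler_pdivrMr// mul1r.
  by rewrite lerDl.
rewrite lee_fin !stateZ// -mulrBr normcM normc_real ger0_norm ?invr_ge0 ?(ltW K0)//.
by rewrite mulrC ler_pdivrMr// mulrC.
Qed.

(** The domain contains only self-adjoint elements: a general [a] is split into its real and
    imaginary parts, each of which is approximated in the domain at the price of the error [e]. *)
Lemma mk_control a (e : R) : 0 < e -> exists2 K : R, 0 < K &
  forall phi psi (r : R), state_space phi -> state_space psi ->
    (mk phi psi <= r%:E)%E -> normc (phi a - psi a) <= e + K * r.
Proof.
have sa_control b (d : R) : 0 < d -> selfadjoint b -> exists2 K : R, 0 < K &
  forall phi psi (r : R), state_space phi -> state_space psi ->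
    (mk phi psi <= r%:E)%E -> normc (phi b - psi b) <= d + K * r.
  move=> d0 sb; have d20 : 0 < d / 2 by rewrite divr_gt0.
  have [c dc bc] := dom_dense sb d20; have [L0 _ _] := lip_seminorm.
  exists (qlip c + 1) => [|phi psi r Sphi Spsi mr]; first by rewrite ltr_wpDl// L0.
  rewrite (_ : phi b - psi b = phi (b - c) - psi (b - c) + (phi c - psi c)); last first.
    by rewrite !stateB//; ring.
  rewrite (le_trans (le_normcD _ _))// lerD ?mk_dom_control//.
  rewrite (le_trans (le_normcD _ _))// normcN (splitr d) lerD//.
    by rewrite (le_trans (state_normc_le _ _)) ?ltW.
  by rewrite (le_trans (state_normc_le _ _)) ?ltW.
move=> e0; have e20 : 0 < e / 2 by rewrite divr_gt0.
pose b := (2^-1 : R)%:C *: (a + star a).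
pose c := (0 +i* - 2^-1)%C *: (a - star a) : X.
have sb : selfadjoint b by rewrite /selfadjoint /= starZR starD starK addrC.
have sc : selfadjoint c.
  rewrite /selfadjoint /= starZc starB starK -(opprB a) scalerN -scaleNr.
  by congr (_ *: _); apply/eqP; rewrite eq_complex /= !opprK oppr0 !eqxx.
have abc : a = b + 'i%C *: c.
  rewrite /b /c scalerA -{1}(scale1r a).
  rewrite (_ : 'i%C * (0 +i* - 2^-1)%C = (2^-1 : R)%:C); last first.
    by rewrite /GRing.mul /=; congr (_ +i* _)%C; ring.
  rewrite -scalerDr [in RHS]addrACA subrr addr0 -mulr2n.
  rewrite -scalerMnr scalerMnl; congr (_ *: _).
  by rewrite -rmorphMn -mulr_natr mulVf.
clearbody b c.
have [K K0 HK] := sa_control b _ e20 sb.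
have [M M0 HM] := sa_control c _ e20 sc.
exists (K + M) => [|phi psi r Sphi Spsi mr]; first by rewrite addr_gt0.
rewrite abc (stateD _ _ Sphi) (stateD _ _ Spsi) (stateZ _ _ Sphi) (stateZ _ _ Spsi).
rewrite opprD addrACA -mulrBr (le_trans (le_normcD _ _))// normcM.
rewrite (_ : normc 'i%C = 1); last first.
  by rewrite /normc /= expr0n expr1n add0r sqrtr1.
rewrite mul1r (splitr e) mulrDl addrACA lerD//; first exact: HK.
exact: HM.
Qed.

(** A weak* neighbourhood contains a ball by [mk_control]; a ball contains a weak* neighbourhood
    because [lip_approx] bounds the metric by finitely many evaluations. *)
Lemma metrizes_mk :
  metrizes (state_space : set {ptws X -> (R[i])^o}) (@monge_kantorovich R X).
Proof.
split.
- by move=> phi psi Sphi Spsi; exact: mk_fin.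
- move=> phi psi Sphi Spsi; split=> [m0|->]; last first.
    apply/eqP; rewrite eq_le mk_ge0 andbT.
    by apply: mk_le => a _ _; rewrite subrr normc0.
  apply/funext => a; apply/eqP; rewrite -subr_eq0; apply/eqP/eq0_normc.
  apply/eqP; rewrite eq_le normc_ge0 andbT; apply/ler_addgt0Pr => e e0.
  have [K _ HK] := mk_control a e0.
  by rewrite (le_trans (HK _ _ 0 Sphi Spsi _)) ?mulr0 ?addr0 ?add0r// /mk m0.
- by move=> *; exact: mkC.
- by move=> *; exact: mk_triangle.
move=> U US; split.
  case=> V Vo UV phi Uphi; have Sphi := US _ Uphi.
  (* [G] is the filter generated by the balls around [phi] in the state space; what is wanted is its
     pointwise convergence to [phi]. *)
  pose G : set_system {ptws X -> (R[i])^o} := [set P | exists2 e : R, 0 < e &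
    forall y, state_space y -> (mk phi y < e%:E)%E -> P y].
  have FG : Filter G.
    split; first by exists 1.
      move=> P Q [e e0 eP] [d d0 dQ]; exists (Num.min e d).
        by rewrite lt_min e0.
      move=> y Sy my; split; [apply: eP|apply: dQ] => //.
        by rewrite (lt_le_trans my)// lee_fin ge_min lexx.
      by rewrite (lt_le_trans my)// lee_fin ge_min lexx orbT.
    by move=> P Q PQ [e e0 eP]; exists e => // y Sy /eP => /(_ Sy)/PQ.
  have Gphi : G --> (phi : {ptws X -> (R[i])^o}).
    apply: ptws_cvg_normc => a e e0; have e20 : 0 < e / 2 by rewrite divr_gt0.
    (* [K] times the radius chosen next is [e / 4], for a total error of [3 e / 4]. *)
    have [K K0 HK] := mk_control a e20.
    exists (e / 4 / K); first by rewrite !divr_gt0.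
    move=> y Sy /ltW my /=; rewrite (le_lt_trans (HK _ _ _ Sphi Sy my))//.
    by rewrite (mulrC K) divfK ?gt_eqF//; lra.
  have [|e e0 eV] := Gphi V.
    by apply: open_nbhs_nbhs; split=> //; move: Uphi; rewrite UV => -[].
  by exists e => // y Sy my; rewrite UV; split => //; exact: eV.
(* The largest open set whose trace on the state space lies in [U]. *)
move=> UB; pose V := \bigcup_(W in [set W : set {ptws X -> (R[i])^o} |
   open W /\ state_space `&` W `<=` U]) W.
exists V; first by apply: bigcup_open => W [].
apply/seteqP; split=> [phi Uphi|y [Sy [W [_ WU] Wy]]]; last by apply: WU.
split; first exact: US.
have Sphi := US _ Uphi; have [e e0 eU] := UB _ Uphi.
have e30 : 0 < e / 3 by rewrite divr_gt0.
have [s [C [C0 HC]]] := lip_approx e30.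
have d0 : 0 < e / 3 / (C + 1) by rewrite !divr_gt0// ltr_wpDl.
have N := ptws_nbhs_sum (phi : {ptws X -> (R[i])^o}) s d0.
(* On this neighbourhood the metric is at most [e / 3 + e / 3]. *)
exists (interior [set g : {ptws X -> (R[i])^o} |
  \sum_(t <- s) normc (phi t - g t) < e / 3 / (C + 1)]); last exact: N.
split; first exact: open_interior.
move=> y [Sy /interior_subset /= sy]; apply: eU => //.
apply: (@le_lt_trans _ _ (e / 3 + e / 3)%:E); last by rewrite lte_fin; lra.
apply: mk_le => a da La; rewrite lee_fin (le_trans (HC _ _ _ da La Sphi Sy))//.
rewrite lerD2l (le_trans (ler_wpM2l C0 (ltW sy)))//.
by rewrite mulrCA ler_piMr ?ltW// ltr_pdivrMr ?mul1r ?ltrDl// ltr_wpDl.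
Qed.

End Metrization.

(** * The Hilbert norm of a faithful state *)

Section TraceNorm.
Context {R : realType} {A : cstarType R}.
Variable tau : {scalar A}.
Hypothesis tau_ge0 : forall a, 0 <= tau (star a * a).
Hypothesis tau1 : tau 1 = 1.
Hypothesis tau_faithful : faithful tau.
Implicit Types (a b c x y : A) (z : R[i]).

Definition gns_norm a : R := Num.sqrt (complex.Re (tau (star a * a))).

Local Notation "'N2' a" := (gns_norm a) (at level 10, a at level 8).

Lemma gns_norm_ge0 a : 0 <= N2 a.
Proof. exact: sqrtr_ge0. Qed.

Lemma gns_norm_sqr a : N2 a ^+ 2 = complex.Re (tau (star a * a)).
Proof. by rewrite sqr_sqrtr// Re_ge0. Qed.

Lemma Re_le_normc z : complex.Re z <= normc z.
Proof.
have := normc_ge_Re z; rewrite -[`|z|]/((normc z)%:C) lecR.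
by apply: le_trans; exact: ler_norm.
Qed.

Lemma gns_Cauchy_Schwarz a b : normc (tau (star a * b)) <= N2 a * N2 b.
Proof.
rewrite -(ler_pXn2r (_ : 0 < 2)%N)// ?nnegrE ?mulr_ge0 ?gns_norm_ge0 ?normc_ge0//.
by rewrite exprMn !gns_norm_sqr positive_Cauchy_Schwarz.
Qed.

Lemma gns_Re_le a b : complex.Re (tau (star a * b)) <= N2 a * N2 b.
Proof. by rewrite (le_trans (Re_le_normc _)) ?gns_Cauchy_Schwarz. Qed.

Lemma gns_norm_le a (K : R) : 0 <= K ->
  complex.Re (tau (star a * a)) <= K ^+ 2 -> N2 a <= K.
Proof.
move=> K0 H; rewrite -(ler_pXn2r (_ : 0 < 2)%N)// ?nnegrE ?gns_norm_ge0//.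
by rewrite gns_norm_sqr.
Qed.

Lemma Re_tau_starC a b :
  complex.Re (tau (star b * a)) = complex.Re (tau (star a * b)).
Proof.
rewrite -[star b * a]starK positive_star// starM starK.
by case: (tau _).
Qed.

Lemma gns_norm_sqrD a b : N2 (a + b) ^+ 2 =
  N2 a ^+ 2 + complex.Re (tau (star a * b)) *+ 2 + N2 b ^+ 2.
Proof.
rewrite !gns_norm_sqr starD mulrDl !mulrDr !linearD /= (Re_tau_starC a b).
by ring.
Qed.

Lemma gns_normD a b : N2 (a + b) <= N2 a + N2 b.
Proof.
rewrite -(ler_pXn2r (_ : 0 < 2)%N)// ?nnegrE ?addr_ge0 ?gns_norm_ge0//.
rewrite gns_norm_sqrD sqrrD lerD2r lerD2l lerMn2r /=.
exact: gns_Re_le.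
Qed.

Lemma gns_normZ z a : N2 (z *: a) = normc z * N2 a.
Proof.
apply/eqP; rewrite -(@eqrXn2 _ 2) ?gns_norm_ge0 ?mulr_ge0 ?normc_ge0 ?gns_norm_ge0//.
rewrite exprMn !gns_norm_sqr starZc -scalerAl -scalerAr scalerA linearZ /=.
rewrite -mulrA.
have := ger0_Im (tau_ge0 a); case: (tau _) => u v /= ->; case: z => s t /=.
have -> := sqr_sqrtr (addr_ge0 (sqr_ge0 s) (sqr_ge0 t)).
by apply/eqP; ring.
Qed.

Lemma gns_norm0 : N2 0 = 0.
Proof. by rewrite -(scale0r 0) gns_normZ normc0 mul0r. Qed.

Lemma gns_normN a : N2 (- a) = N2 a.
Proof. by rewrite -scaleN1r gns_normZ normcN normc1 mul1r. Qed.

Lemma gns_norm1 : N2 1 = 1.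
Proof. by rewrite /gns_norm star1 mul1r tau1 sqrtr1. Qed.

Lemma gns_norm_eq0 a : N2 a = 0 -> a = 0.
Proof.
move=> a0; apply: tau_faithful.
have := gns_norm_sqr a; rewrite a0 expr0n /=.
by have := ger0_Im (tau_ge0 a); case: (tau _) => u v /= -> <-.
Qed.

(** [y |-> tau (star x * y * x)] is a positive functional with value [N2 x ^+ 2] at 1; the bound for
    such functionals is applied at [star a * a]. *)
Lemma gns_normM a x : N2 (a * x) <= cnorm a * N2 x.
Proof.
have lin : scalar (fun y => tau (star x * y * x)).
  by move=> z u v; rewrite mulrDr mulrDl -scalerAr -scalerAl linearP.
pose f : {scalar A} :=
  HB.pack (fun y => tau (star x * y * x)) (GRing.isLinear.Build R[i] A R[i] _ _ lin).
have f_ge0 y : 0 <= f (star y * y).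
  by rewrite /f /= !mulrA -mulrA -starM.
apply: gns_norm_le; first by rewrite mulr_ge0 ?cnorm_ge0 ?gns_norm_ge0.
have -> : tau (star (a * x) * (a * x)) = f (star a * a).
  by rewrite /f /= starM !mulrA.
rewrite (le_trans (positive_Re_le f_ge0 _)) ?starM ?starK//.
by rewrite exprMn gns_norm_sqr cnorm_star mulrC /f /= mulr1.
Qed.

Lemma subalg_sum (B : cstar_subalgebra A) (I : eqType) (r : seq I) (F : I -> A) :
  (forall i, i \in r -> subalg_set B (F i)) -> subalg_set B (\sum_(i <- r) F i).
Proof.
elim: r => [|i r IHr] BF; first by rewrite big_nil -(scale0r 1); apply/subalgZ/subalg1.
rewrite big_cons; apply: subalgD; first by apply: BF; rewrite mem_head.
by apply: IHr => j jr; apply: BF; rewrite inE jr orbT.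
Qed.

Lemma subalgB (B : cstar_subalgebra A) a b :
  subalg_set B a -> subalg_set B b -> subalg_set B (a - b).
Proof. by move=> Ba Bb; rewrite -scaleN1r; apply/subalgD/subalgZ. Qed.

Definition gns_expansion (e : seq A) b : A := \sum_(x <- e) tau (star x * b) *: x.

Lemma gns_expansion_linear (e : seq A) : linear (gns_expansion e).
Proof.
move=> z a b; rewrite /gns_expansion scaler_sumr -big_split /=.
by apply: eq_bigr => x _; rewrite mulrDr -scalerAr linearP scalerDl scalerA.
Qed.

(* Gram-Schmidt. *)
Lemma gns_orthonormal_basis (B : cstar_subalgebra A) : finite_dimensional B ->
  exists e : seq A, (forall x, x \in e -> subalg_set B x) /\
    forall b, subalg_set B b -> b = gns_expansion e b.
Proof.
case=> s [sB sspan].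
(* In place of orthonormality, the induction keeps that the expansion along [e] fixes every member
   of [e]; this is enough to make the remainder [y] orthogonal to [e]. *)
suff [e [eB [_ ee]]] : exists e : seq A, (forall x, x \in e -> subalg_set B x) /\
    (forall x, x \in e -> gns_expansion e x = x) /\
    forall x, x \in s -> gns_expansion e x = x.
  exists e; split=> // b /sspan[c ->].
  pose P : {linear A -> A} := HB.pack (gns_expansion e)
    (GRing.isLinear.Build R[i] A A _ _ (gns_expansion_linear e)).
  rewrite -[gns_expansion e]/(P : A -> A) linear_sum; apply: eq_bigr => i _.
  by rewrite linearZ /=; congr (_ *: _); apply/esym/ee/mem_nth.
elim: s sB {sspan} => [|x s IHs] sB; first by exists [::].
have [|e [eB [ee es]]] := IHs; first by move=> y ys; apply: sB; rewrite inE ys orbT.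
have Bx : subalg_set B x by apply: sB; rewrite mem_head.
pose y := x - gns_expansion e x.
have By : subalg_set B y.
  by apply: subalgB => //; apply: subalg_sum => i /eB; exact: subalgZ.
have ey w : w \in e -> tau (star w * y) = 0.
  move=> we; rewrite mulrBr linearB /=; apply/eqP; rewrite subr_eq0; apply/eqP.
  rewrite -{1}(ee w we) /gns_expansion mulr_sumr raddf_sum /=.
  rewrite (big_morph star (@starD R A) (@star0 R A)) mulr_suml raddf_sum /=.
  apply: eq_bigr => v _; rewrite starZc -scalerAl -scalerAr !linearZ /=.
  by rewrite -positive_star// starM starK mulrC.
have [y0|y0] := eqVneq y 0.
  exists e; split => //; split => // v; rewrite inE => /orP[/eqP ->|/es//].
  by apply/eqP; rewrite eq_sym -subr_eq0 -/y y0.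
have N0 : 0 < N2 y.
  by rewrite lt0r gns_norm_ge0 andbT; apply: contra y0 => /eqP/gns_norm_eq0 ->.
pose u := (N2 y)^-1%:C *: y.
have ue w : w \in e -> tau (star w * u) = 0.
  by move=> we; rewrite -scalerAr linearZ /= ey// mulr0.
have eu w : w \in e -> tau (star u * w) = 0.
  by move=> we; rewrite -[star u * w]starK positive_star// starM starK ue// conjc0.
have uu : tau (star u * u) = 1.
  rewrite starZR -scalerAl -scalerAr !linearZ /= -(RRe_real (ger0_real (tau_ge0 y))).
  by rewrite -gns_norm_sqr -!rmorphM /= mulrA -invfM -expr2 mulVf// sqrf_eq0 gt_eqF.
have uP v : tau (star u * gns_expansion e v) = 0.
  rewrite mulr_sumr raddf_sum /= big_seq big1// => w we.
  by rewrite -scalerAr linearZ /= eu// mulr0.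
have PE v : gns_expansion (u :: e) v = tau (star u * v) *: u + gns_expansion e v.
  by rewrite /gns_expansion big_cons.
have Bu : subalg_set B u by exact: subalgZ.
have xE : x = (N2 y)%:C *: u + gns_expansion e x.
  by rewrite scalerA /= -rmorphM /= divff ?gt_eqF// scale1r subrK.
clearbody u; exists (u :: e); split.
  by move=> v; rewrite inE => /orP[/eqP ->|/eB].
split=> v; rewrite inE PE => /orP[/eqP ->|vin].
- rewrite uu scale1r [X in _ + X](_ : _ = 0) ?addr0//.
  by rewrite /gns_expansion big_seq big1// => w we; rewrite ue// scale0r.
- by rewrite eu// scale0r add0r ee.
- rewrite {1}xE mulrDr linearD /= uP addr0 -scalerAr linearZ /= uu mulr1.
  exact/esym.
- by rewrite -{1}(es v vin) uP scale0r add0r es.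
Qed.

Lemma cnorm_le_gns_norm (B : cstar_subalgebra A) : finite_dimensional B ->
  exists2 C : R, 0 <= C & forall b, subalg_set B b -> cnorm b <= C * N2 b.
Proof.
move=> /gns_orthonormal_basis[e [_ eP]].
exists (\sum_(x <- e) N2 x * cnorm x) => [|b /eP {1}->].
  by rewrite sumr_ge0// => x _; rewrite mulr_ge0 ?gns_norm_ge0 ?cnorm_ge0.
rewrite (le_trans (cnorm_sum _ _))// mulr_suml ler_sum// => x _.
by rewrite cnormZc mulrAC ler_wpM2r ?cnorm_ge0 ?gns_Cauchy_Schwarz.
Qed.

(* [N := cnorm] and the operator norm on the pre-Hilbert space of [tau] are
   equivalent on a finite-dimensional subalgebra, and equal there because
   [N (h ^+ 2) = N h ^+ 2] for [h] self-adjoint. *)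
Lemma cnorm_le_opnorm (B : cstar_subalgebra A) x (M : R) :
  finite_dimensional B -> subalg_set B x -> 0 <= M ->
  (forall b, subalg_set B b -> N2 (x * b) <= M * N2 b) -> cnorm x <= M.
Proof.
move=> /cnorm_le_gns_norm[C C0 CB] Bx M0 xM.
(* The adjoint obeys the same bound: [|x^* b|^2] is the inner product of [b] and [x x^* b]. *)
have xM' b : subalg_set B b -> N2 (star x * b) <= M * N2 b.
  move=> Bb; have [->|n0] := eqVneq (N2 (star x * b)) 0.
    by rewrite mulr_ge0 ?gns_norm_ge0.
  have {}n0 : 0 < N2 (star x * b) by rewrite lt0r n0 gns_norm_ge0.
  rewrite -(ler_pM2r n0) -expr2 gns_norm_sqr starM starK -mulrA.
  rewrite (le_trans (gns_Re_le _ _))// mulrC mulrAC ler_wpM2r ?gns_norm_ge0//.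
  by apply: xM; apply: subalgM => //; exact: subalg_star.
pose h := star x * x.
have Bh : subalg_set B h by apply: subalgM => //; exact: subalg_star.
have hk k : subalg_set B (h ^+ k).
  by elim: k => [|k IHk]; [exact: subalg1|rewrite exprS; exact: subalgM].
have hM k : N2 (h ^+ k) <= (M ^+ 2) ^+ k.
  elim: k => [|k IHk]; first by rewrite gns_norm1.
  rewrite [h ^+ _]exprS [_ ^+ k.+1]exprS -[h * _]mulrA.
  rewrite (le_trans (xM' _ _))//; first exact: subalgM.
  by rewrite expr2 -mulrA ler_wpM2l// (le_trans (xM _ _))// ler_wpM2l.
have sh k : star (h ^+ k) = h ^+ k.
  elim: k => [|k IHk]; first exact: star1.
  by rewrite exprS starM IHk {2}/h starM starK -/h -exprSr exprS.
have hj j : cnorm (h ^+ (2 ^ j)) = cnorm h ^+ (2 ^ j).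
  elim: j => [//|j IHj].
  by rewrite expnSr exprM expr2 -{1}sh cnorm_star IHj -exprM.
rewrite leNgt; apply/negP => xgtM.
have x0 : 0 < cnorm x := le_lt_trans M0 xgtM.
pose r := M / cnorm x.
have r0 : 0 <= r by rewrite divr_ge0 ?cnorm_ge0.
have r1 : r < 1 by rewrite ltr_pdivrMr// mul1r.
(* Since [cnorm h = cnorm x ^+ 2], the bounds on [h ^+ (2 ^ j)] compare [cnorm x ^+ (2 * 2 ^ j)]
   with [C * M ^+ (2 * 2 ^ j)]; as [r < 1], this fails for large [j]. *)
have Cr j : 1 <= C * (r ^+ 2) ^+ (2 ^ j).
  rewrite -exprM expr_div_n mulrA ler_pdivlMr ?exprn_gt0// mul1r exprM.
  by rewrite -cnorm_star -hj (le_trans (CB _ (hk _)))// ler_wpM2l// exprM.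
have C10 : 0 < C + 1 by rewrite ltr_wpDl.
have /cvgrPdist_lt/(_ _ (divr_gt0 ltr01 C10))[n _ nr] : r ^+ n @[n --> \oo] --> 0.
  by apply: cvg_expr; rewrite ger0_norm.
have := nr n (leqnn n); rewrite /= sub0r normrN ger0_norm ?exprn_ge0// => rn.
have := Cr n; rewrite leNgt => /negP; apply.
apply: (@le_lt_trans _ _ (C * r ^+ n)).
  rewrite ler_wpM2l// -exprM ler_wiXn2l// ?ltW//.
  by rewrite (leq_trans (ltnW (ltn_expl n (isT : 1 < 2)%N)))// leq_pmull.
rewrite (le_lt_trans (ler_wpM2l C0 (ltW rn)))//.
by rewrite mul1r ltr_pdivrMr// mul1r ltrDl.
Qed.

End TraceNorm.

(** * Frobenius-Rieffel norms *)

Section FrobeniusRieffel.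
Context {R : realType} {A : cstarType R}.
Variable tau : {scalar A}.
Hypothesis tau_ge0 : forall a, 0 <= tau (star a * a).
Hypothesis tau1 : tau 1 = 1.
Hypothesis tau_faithful : faithful tau.
Implicit Types (a b c x y v : A) (z : R[i]).

Local Notation "'N2' a" := (gns_norm tau a) (at level 10, a at level 8).

Variables (B : cstar_subalgebra A) (E : A -> A).
Hypothesis B_fin : finite_dimensional B.
Hypothesis E_cond : conditional_expectation B E.
Hypothesis tauE : tau \o E = tau.

Local Notation "a \inB" := (subalg_set B a) (at level 70).

Lemma condexpD a b : E (a + b) = E a + E b.
Proof. by case: E_cond => lin _ _ _ _; have := lin 1 a b; rewrite !scale1r. Qed.

Lemma condexpZ z a : E (z *: a) = z *: E a.
Proof.
case: E_cond => lin _ _ _ _.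
have E0 : E 0 = 0 by have := lin (-1) 0 0; rewrite scaleN1r oppr0 addr0 scaleN1r addNr.
by have := lin z a 0; rewrite !addr0 E0 addr0.
Qed.

Lemma condexpB a b : E (a - b) = E a - E b.
Proof. by rewrite -scaleN1r condexpD condexpZ scaleN1r. Qed.

Lemma condexp_in a : E a \inB.
Proof. by case: E_cond. Qed.

Lemma condexp_id b : b \inB -> E b = b.
Proof. by case: E_cond => _ _ Eid _ _; exact: Eid. Qed.

Lemma condexp_le a : cnorm (E a) <= cnorm a.
Proof. by case: E_cond. Qed.

Lemma condexpMr a b : b \inB -> E (a * b) = E a * b.
Proof.
case: E_cond => _ _ _ _ Ebi Bb.
by have := Ebi a 1 b (subalg1 B) Bb; rewrite !mul1r.
Qed.

Lemma condexpMl a b : b \inB -> E (b * a) = b * E a.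
Proof.
case: E_cond => _ _ _ _ Ebi Bb.
by have := Ebi a b 1 Bb (subalg1 B); rewrite !mulr1.
Qed.

Lemma tau_condexp a : tau (E a) = tau a.
Proof. by rewrite -[in RHS]tauE. Qed.

Lemma tau_condexpMl a c : c \inB -> tau (star c * E a) = tau (star c * a).
Proof. by move=> Bc; rewrite -condexpMl ?tau_condexp//; exact: subalg_star. Qed.

Lemma condexp_orth a c : c \inB -> tau (star c * (a - E a)) = 0.
Proof. by move=> Bc; rewrite mulrBr linearB /= tau_condexpMl// subrr. Qed.

(** [E a - b] lies in [B] and is orthogonal to [B], hence to itself, and faithfulness concludes.
    Adjoints and towers of expectations are computed with this criterion. *)
Lemma condexp_unique a b : b \inB ->
  (forall c, c \inB -> tau (star c * b) = tau (star c * a)) -> E a = b.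
Proof.
move=> Bb H; apply/eqP; rewrite -subr_eq0; apply/eqP/tau_faithful.
have Bd : E a - b \inB by apply: subalgB => //; exact: condexp_in.
by rewrite mulrBr linearB /= tau_condexpMl// H// subrr.
Qed.

Lemma condexp_star a : E (star a) = star (E a).
Proof.
apply: condexp_unique => [|c Bc]; first exact/subalg_star/condexp_in.
rewrite -[star c * _]starK positive_star// starM !starK -condexpMr// tau_condexp.
by rewrite -positive_star// starM.
Qed.

Lemma gns_condexp_sqr a : N2 a ^+ 2 = N2 (E a) ^+ 2 + N2 (a - E a) ^+ 2.
Proof.
have aE : a = E a + (a - E a) by rewrite addrC subrK.
rewrite {1}aE gns_norm_sqrD// (condexp_orth _ (condexp_in _)).
by rewrite mul0rn addr0.
Qed.

Lemma gns_condexp_le a : N2 (E a) <= N2 a.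
Proof.
rewrite -(ler_pXn2r (_ : 0 < 2)%N)// ?nnegrE ?gns_norm_ge0//.
by rewrite (gns_condexp_sqr a) lerDl sqr_ge0.
Qed.

Lemma gns_sub_condexp_le a : N2 (a - E a) <= N2 a.
Proof.
rewrite -(ler_pXn2r (_ : 0 < 2)%N)// ?nnegrE ?gns_norm_ge0//.
by rewrite (gns_condexp_sqr a) lerDr sqr_ge0.
Qed.

(** Let [T] be left multiplication by [a] from [B] to [A]. Then [E (star a * a)] acts on [B] as
    [T^* T], and the identity is [<c, T^* T c> = |T c|^2]. *)
Lemma gns_norm_condexp_absM a c : c \inB ->
  complex.Re (tau (star c * (E (star a * a) * c))) = N2 (a * c) ^+ 2.
Proof.
move=> Bc; rewrite -condexpMr// tau_condexpMl// gns_norm_sqr// starM.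
by rewrite !mulrA.
Qed.

(** With the same [T], this is [|T^* T c| <= |T| |T c|], obtained by pairing [h * c] with itself. *)
Lemma gns_condexp_abs_le a c (K : R) : 0 <= K -> c \inB ->
  (forall b, b \inB -> N2 (a * b) <= K * N2 b) ->
  N2 (E (star a * a) * c) <= K * N2 (a * c).
Proof.
move=> K0 Bc aK; set h := E (star a * a).
have Bhc : h * c \inB by apply: subalgM => //; exact: condexp_in.
have [->|n0] := eqVneq (N2 (h * c)) 0; first by rewrite mulr_ge0 ?gns_norm_ge0.
have {}n0 : 0 < N2 (h * c) by rewrite lt0r n0 gns_norm_ge0.
rewrite -(ler_pM2r n0) -expr2 gns_norm_sqr//.
rewrite [in X in _ * X](_ : h * c = E (star a * a * c)); last by rewrite condexpMr.
rewrite tau_condexpMl// -[star a * a * c]mulrA mulrA -starM.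
rewrite (le_trans (gns_Re_le tau_ge0 _ _))// mulrAC ler_wpM2r ?gns_norm_ge0//.
exact: aK.
Qed.

(* The Frobenius-Rieffel norm of [a] is the norm of left multiplication by [a] from
   [B] to [A], both with the Hilbert norm of [tau]. *)
Lemma frobenius_rieffelP a (K : R) : 0 <= K ->
  frobenius_rieffel_norm E a <= K <->
  forall b, b \inB -> N2 (a * b) <= K * N2 b.
Proof.
move=> K0; split=> [aK b Bb|aK].
  apply: gns_norm_le => //; first by rewrite mulr_ge0 ?gns_norm_ge0.
  rewrite -gns_norm_sqr// -gns_norm_condexp_absM// (le_trans (gns_Re_le _ _ _))//.
  rewrite exprMn mulrC expr2 [X in _ <= _ * X]expr2 mulrA ler_wpM2r ?gns_norm_ge0//.
  rewrite (le_trans (gns_normM _ _ _))// ler_wpM2r ?gns_norm_ge0//.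
  by rewrite -expr2 -(sqr_sqrtr (cnorm_ge0 _)) ler_pXn2r ?nnegrE ?sqrtr_ge0.
rewrite -(ler_pXn2r (_ : 0 < 2)%N)// ?nnegrE ?sqrtr_ge0//.
rewrite /frobenius_rieffel_norm sqr_sqrtr ?cnorm_ge0//.
apply: (cnorm_le_opnorm tau_ge0 tau1 tau_faithful B_fin) => [||b Bb].
- exact: condexp_in.
- by rewrite sqr_ge0.
- rewrite (le_trans (gns_condexp_abs_le K0 Bb aK))// expr2 -mulrA.
  by rewrite ler_wpM2l// aK.
Qed.

Lemma frobenius_rieffel_ge0 a : 0 <= frobenius_rieffel_norm E a.
Proof. exact: sqrtr_ge0. Qed.

(* [M - E (a^* a)], with [M] the norm of [E (a^* a)], has norm at most [M]. *)
Lemma condexp_abs_positive (f : {scalar (subalg_type B)}) (x : subalg_type B) a :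
  (forall y : subalg_type B, 0 <= f (star y * y)) -> val x = E (star a * a) -> 0 <= f x.
Proof.
move=> f_ge0 xE; set M := cnorm (E (star a * a)).
have M0 : 0 <= M := cnorm_ge0 _.
have sx : star x = x.
  apply: val_inj; change (star (val x : A) = val x); rewrite xE.
  by rewrite -condexp_star starM starK.
have hK b : b \inB -> N2 (a * b) <= Num.sqrt M * N2 b.
  exact: (proj1 (frobenius_rieffelP a (sqrtr_ge0 M)) (lexx _)).
have cM : cnorm (M%:C *: 1 - x) <= M.
  change (cnorm (M%:C *: (1 : A) - val x) <= M); rewrite xE.
  apply: (cnorm_le_opnorm tau_ge0 tau1 tau_faithful B_fin) => // [|b Bb].
    by apply: subalgB; [exact/subalgZ/subalg1|exact: condexp_in].
  apply: gns_norm_le => //; first by rewrite mulr_ge0 ?gns_norm_ge0.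
  (* With [h = E (a^* a)], [|(M - h) b|^2 = M^2 |b|^2 - 2 M |a b|^2 + |h b|^2], and
     [|h b|^2 <= M |a b|^2]. *)
  rewrite -gns_norm_sqr// mulrBl -scalerAl mul1r addrC gns_norm_sqrD// gns_normN//.
  rewrite -scalerAr linearZ /= ReZ starN mulNr linearN ReN Re_tau_starC//.
  rewrite gns_norm_condexp_absM// gns_normZ// normc_real ger0_norm//.
  have H : N2 (E (star a * a) * b) ^+ 2 <= M * N2 (a * b) ^+ 2.
    rewrite -[X in _ <= X * _](sqr_sqrtr M0) -exprMn.
    rewrite ler_pXn2r ?nnegrE ?mulr_ge0 ?sqrtr_ge0 ?gns_norm_ge0//.
    by apply: gns_condexp_abs_le => //; rewrite sqrtr_ge0.
  have : 0 <= M * N2 (a * b) ^+ 2 by rewrite mulr_ge0 ?sqr_ge0.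
  by lra.
have sMx : star (M%:C *: 1 - x) = M%:C *: 1 - x by rewrite starB starZR star1 sx.
have f1 : 0 <= complex.Re (f 1) by apply: Re_ge0; have := f_ge0 1; rewrite star1 mul1r.
(* [f (M - x) <= M * f 1] leaves [f x >= 0] once [f x] is known to be real. *)
have := positive_Re_le f_ge0 sMx; rewrite linearB linearZ /= ReD ReN ReZ => H.
have {}H := le_trans H (ler_wpM2l f1 cM).
have If : complex.Im (f x) = 0.
  have := positive_star f_ge0 x; rewrite sx; case: (f x) => s t [] /=.
  by move=> H1; lra.
rewrite lecE If eqxx /=; move: H; rewrite mulrC lerBlDr -subr_ge0.
by rewrite addrAC subrr add0r.
Qed.

Definition deviation a : R := frobenius_rieffel_norm E (a - E a).

Lemma deviationP a (K : R) : 0 <= K -> deviation a <= K <->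
  forall b, b \inB -> N2 (a * b - E (a * b)) <= K * N2 b.
Proof.
move=> K0; have DM b : b \inB -> (a - E a) * b = a * b - E (a * b).
  by move=> Bb; rewrite mulrBl condexpMr.
split=> H.
  by move=> b Bb; rewrite -DM//; have /frobenius_rieffelP := H; exact.
by apply/frobenius_rieffelP => // b Bb; rewrite DM// H.
Qed.

Lemma deviation_ge0 a : 0 <= deviation a.
Proof. exact: frobenius_rieffel_ge0. Qed.

Lemma deviation_gns a b : b \inB -> N2 (a * b - E (a * b)) <= deviation a * N2 b.
Proof. exact: (proj1 (deviationP a (deviation_ge0 a)) (lexx _)). Qed.

Lemma deviationD a b : deviation (a + b) <= deviation a + deviation b.
Proof.
apply/deviationP => [|c Bc]; first by rewrite addr_ge0 ?deviation_ge0.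
rewrite mulrDl condexpD opprD addrACA (le_trans (gns_normD tau_ge0 _ _))//.
by rewrite mulrDl lerD ?deviation_gns.
Qed.

Lemma deviationZ_le z a : deviation (z *: a) <= normc z * deviation a.
Proof.
apply/deviationP => [|c Bc]; first by rewrite mulr_ge0 ?deviation_ge0 ?normc_ge0.
rewrite -scalerAl condexpZ -scalerBr gns_normZ// -mulrA.
by rewrite ler_wpM2l ?normc_ge0 ?deviation_gns.
Qed.

Lemma deviation_le_cnorm a : deviation a <= cnorm a.
Proof.
apply/deviationP => [|c Bc]; first exact: cnorm_ge0.
by rewrite (le_trans (gns_sub_condexp_le _)) ?gns_normM.
Qed.

Lemma deviation_in b : b \inB -> deviation b = 0.
Proof.
move=> Bb; apply/eqP; rewrite eq_le deviation_ge0 andbT.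
apply/deviationP => // c Bc; rewrite condexp_id ?subrr ?gns_norm0 ?mul0r//.
exact: subalgM.
Qed.

(** [(1 - E) a b E = (1 - E) a E b E + (1 - E) a (1 - E) b E], where [E] and [1 - E] contract the
    Hilbert norm. *)
Lemma deviationM a b : deviation (a * b) <= deviation a * cnorm b + cnorm a * deviation b.
Proof.
apply/deviationP => [|c Bc].
  by rewrite addr_ge0 ?mulr_ge0 ?deviation_ge0 ?cnorm_ge0.
rewrite -mulrA -(subrK (E (b * c)) (b * c)) mulrDr condexpD opprD addrACA addrC.
rewrite (le_trans (gns_normD tau_ge0 _ _))// mulrDl lerD//.
  rewrite (le_trans (deviation_gns _ (condexp_in _)))// -mulrA.
  rewrite ler_wpM2l ?deviation_ge0// (le_trans (gns_condexp_le _))//.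
  exact: gns_normM.
rewrite (le_trans (gns_sub_condexp_le _))// (le_trans (gns_normM _ _ _))//.
by rewrite -mulrA ler_wpM2l ?cnorm_ge0 ?deviation_gns.
Qed.

(* With [P = E] the orthogonal projection on [B], this bounds the commutator
   [P a - a P = P a (1 - P) - (1 - P) a P], whose two terms are, up to sign,
   adjoint to each other. *)
Lemma gns_commutator_le a v : star a = a ->
  N2 (E (a * v) - a * E v) <= deviation a * N2 v.
Proof.
move=> sa; set w := v - E v; set u := E (a * w).
have Bu : u \inB := condexp_in _.
have l0 := deviation_ge0 a.
have vE : v = E v + w by rewrite addrC subrK.
(* [|u|^2 = <a u, w>], and since [w] is orthogonal to [B] only the part [a u - E (a u)]
   contributes. *)
have uw : N2 u <= deviation a * N2 w.
  have [->|n0] := eqVneq (N2 u) 0; first by rewrite mulr_ge0 ?gns_norm_ge0.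
  have {}n0 : 0 < N2 u by rewrite lt0r n0 gns_norm_ge0.
  rewrite -(ler_pM2r n0) -expr2 gns_norm_sqr// {2}/u tau_condexpMl//.
  rewrite mulrA -{1}sa -starM.
  have -> : tau (star (a * u) * w) = tau (star (a * u - E (a * u)) * w).
    by rewrite starB mulrBl linearB /= (condexp_orth _ (condexp_in _)) subr0.
  rewrite (le_trans (gns_Re_le tau_ge0 _ _))// mulrAC ler_wpM2r ?gns_norm_ge0//.
  exact: deviation_gns.
have cE : E (a * v) - a * E v = u - (a * E v - E (a * E v)).
  by rewrite {1}vE mulrDr condexpD -/u [E _ + u]addrC opprB addrA.
have Ec : E (E (a * v) - a * E v) = u.
  by rewrite condexpB {1}vE mulrDr condexpD condexpD -/u (condexp_id Bu)
    (condexp_id (condexp_in _)) addrAC subrr add0r.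
(* The value of the commutator at [v] has the component [u] in [B] and, up to sign, the component
   [a E v - E (a E v)] orthogonal to [B]. Pythagoras on both sides recombines the bounds by [|w|]
   and [|E v|] into one by [|v|]. *)
apply: gns_norm_le => //; first by rewrite mulr_ge0 ?gns_norm_ge0.
rewrite -gns_norm_sqr// gns_condexp_sqr Ec {1}cE addrAC subrr add0r gns_normN//.
rewrite exprMn (gns_condexp_sqr v) mulrDr addrC -/w lerD//.
  rewrite -exprMn ler_pXn2r ?nnegrE ?mulr_ge0 ?gns_norm_ge0//.
  by apply: deviation_gns; exact: condexp_in.
by rewrite -exprMn ler_pXn2r ?nnegrE ?mulr_ge0 ?gns_norm_ge0.
Qed.

(** For [c] in [B], [a b c = c] is fixed by [E], so that [b c - E (b c)] is [b] times the commutator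
    of [E] and [a] evaluated at [b c]; each of the two [b] contributes a factor [cnorm b]. *)
Lemma deviationV a b : star a = a -> inverse_of a b ->
  deviation b <= cnorm b ^+ 2 * deviation a.
Proof.
move=> sa [ab ba]; apply/deviationP => [|c Bc].
  by rewrite mulr_ge0 ?exprn_ge0 ?deviation_ge0 ?cnorm_ge0.
have -> : b * c - E (b * c) = b * (E (a * (b * c)) - a * E (b * c)).
  by rewrite mulrBr !mulrA ab ba !mul1r (condexp_id Bc).
rewrite (le_trans (gns_normM _ _ _))// expr2 -!mulrA ler_wpM2l ?cnorm_ge0//.
rewrite (le_trans (gns_commutator_le _ sa))// mulrCA ler_wpM2l ?deviation_ge0//.
exact: gns_normM.
Qed.

End FrobeniusRieffel.

(** * Nested conditional expectations *)

Section NestedExpectations.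
Context {R : realType} {A : cstarType R}.
Variable tau : {scalar A}.
Hypothesis tau_ge0 : forall a, 0 <= tau (star a * a).
Hypothesis tau1 : tau 1 = 1.
Hypothesis tau_faithful : faithful tau.
Variables (B C : cstar_subalgebra A) (E F : A -> A).
Hypothesis B_fin : finite_dimensional B.
Hypothesis C_fin : finite_dimensional C.
Hypothesis E_cond : conditional_expectation B E.
Hypothesis F_cond : conditional_expectation C F.
Hypothesis tauE : tau \o E = tau.
Hypothesis tauF : tau \o F = tau.
Hypothesis BC : B `<=` C.

Lemma condexp_tower a : E (F a) = E a.
Proof.
apply/esym/(condexp_unique tau_faithful E_cond tauE); first exact: (condexp_in E_cond).
move=> c Bc; rewrite (tau_condexpMl E_cond tauE)//.
by rewrite (tau_condexpMl F_cond tauF)//; exact: BC.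
Qed.

(** Right multiplication by [c] in [B] passes through [F], so that
    [F a c - E (F a c) = F (a c - E (a c))], and [F] contracts the Hilbert norm. *)
Lemma deviation_condexp_le a : deviation E (F a) <= deviation E a.
Proof.
apply/(deviationP tau_ge0 tau1 tau_faithful B_fin E_cond tauE).
  exact: deviation_ge0.
move=> c Bc; have Cc := BC Bc.
rewrite -(condexpMr F_cond)// condexp_tower.
have -> : F (a * c) - E (a * c) = F (a * c - E (a * c)).
  rewrite (condexpB F_cond) [F (E _)](condexp_id F_cond)//.
  by apply: BC; exact: (condexp_in E_cond).
rewrite (le_trans (gns_condexp_le tau_ge0 F_cond tauF _))//.
exact: (deviation_gns tau_ge0 tau1 tau_faithful B_fin E_cond tauE).
Qed.

End NestedExpectations.

(** * Suprema of strongly Leibniz seminorms *)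

Section StronglyLeibnizSeminorms.
Context {R : realType}.
Implicit Types A B : cstarType R.

(** The algebraic and continuity conditions asked of each member of a family whose supremum is to be
    a strongly Leibniz L-seminorm. They are stable under scaling and under composition with
    contractive unital morphisms; [sl_bounded] serves the closedness of the unit ball. *)
Record strongly_leibniz_seminorm A (d : A -> R) : Prop := StronglyLeibnizSeminorm {
  slD : forall a b, d (a + b) <= d a + d b ;
  slZ : forall (z : R[i]) a, d (z *: a) <= normc z * d a ;
  sl1 : d 1 = 0 ;
  slM : forall a b, d (a * b) <= d a * cnorm b + cnorm a * d b ;
  slV : forall a b, star a = a -> inverse_of a b -> d b <= cnorm b ^+ 2 * d a ;
  sl_bounded : exists2 C : R, 0 <= C & forall a, d a <= C * cnorm a
}.

Lemma sl_ge0 A (d : A -> R) a : strongly_leibniz_seminorm d -> 0 <= d a.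
Proof.
move=> dS; have := slD dS 0 0; rewrite addr0 => d0.
have := slZ dS (-1) a; rewrite scaleN1r normcN normc1 mul1r => dN.
by have := slD dS a (- a); rewrite subrr; lra.
Qed.

Lemma sl_scale A (d : A -> R) (c : R) : 0 <= c -> strongly_leibniz_seminorm d ->
  strongly_leibniz_seminorm (fun a => d a * c).
Proof.
move=> c0 dS; split.
- by move=> a b; rewrite -mulrDl ler_wpM2r// slD.
- by move=> z a; rewrite mulrA ler_wpM2r// slZ.
- by rewrite sl1// mul0r.
- move=> a b; rewrite mulrAC mulrA -mulrDl ler_wpM2r//; exact: slM.
- by move=> a b sa ab; rewrite mulrA ler_wpM2r// slV.
- have [C C0 dC] := sl_bounded dS; exists (C * c); first exact: mulr_ge0.
  by move=> a; rewrite mulrAC ler_wpM2r.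
Qed.

Record unital_star_contraction A B (f : A -> B) : Prop := UnitalStarContraction {
  usc_morphism : star_morphism f ;
  usc1 : f 1 = 1 ;
  usc_le : forall a, cnorm (f a) <= cnorm a
}.

Section Contractions.
Variables (A B : cstarType R) (f : A -> B).
Hypothesis fS : unital_star_contraction f.

Lemma uscD a b : f (a + b) = f a + f b.
Proof. by case: fS => -[lin _ _] _ _; have := lin 1 a b; rewrite !scale1r. Qed.

Lemma uscZ (z : R[i]) a : f (z *: a) = z *: f a.
Proof.
case: fS => -[lin _ _] _ _.
have f0 : f 0 = 0 by have := lin (-1) 0 0; rewrite scaleN1r oppr0 addr0 scaleN1r addNr.
by have := lin z a 0; rewrite !addr0 f0 addr0.
Qed.

Lemma uscM a b : f (a * b) = f a * f b.
Proof. by case: fS => -[]. Qed.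

Lemma usc_star a : f (star a) = star (f a).
Proof. by case: fS => -[]. Qed.

Lemma usc_inverse a b : inverse_of a b -> inverse_of (f a) (f b).
Proof. by move=> [ab ba]; split; rewrite -uscM ?ab ?ba (usc1 fS). Qed.

Lemma sl_comp (d : B -> R) : strongly_leibniz_seminorm d ->
  strongly_leibniz_seminorm (d \o f).
Proof.
move=> dS; split=> /=.
- by move=> a b; rewrite uscD slD.
- by move=> z a; rewrite uscZ slZ.
- by rewrite (usc1 fS) sl1.
- move=> a b; rewrite uscM (le_trans (slM dS _ _))// lerD//.
    by rewrite ler_wpM2l ?sl_ge0 ?(usc_le fS).
  by rewrite ler_wpM2r ?sl_ge0 ?(usc_le fS).
- move=> a b sa /usc_inverse ab.
  rewrite (le_trans (slV dS _ ab)) -?usc_star ?sa//.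
  by rewrite ler_wpM2r ?sl_ge0// ler_pXn2r ?nnegrE ?cnorm_ge0 ?(usc_le fS).
- have [C C0 dC] := sl_bounded dS; exists C => // a.
  by rewrite (le_trans (dC _))// ler_wpM2l ?(usc_le fS).
Qed.

End Contractions.

(** Products use [f a f b - g a g b = (f a - g a) f b + g a (f b - g b)], inverses use
    [f b - g b = f b (g a - f a) g b]. The bridge term of the tunnel has this form. *)
Lemma sl_distance A B (f g : A -> B) :
  unital_star_contraction f -> unital_star_contraction g ->
  strongly_leibniz_seminorm (fun a => cnorm (f a - g a)).
Proof.
move=> fS gS; split.
- by move=> a b; rewrite (uscD fS) (uscD gS) opprD addrACA cnormD.
- by move=> z a; rewrite (uscZ fS) (uscZ gS) -scalerBr cnormZc.
- by rewrite (usc1 fS) (usc1 gS) subrr cnorm0.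
- move=> a b; rewrite (uscM fS) (uscM gS) addrC.
  have -> : - (g a * g b) + f a * f b = (f a - g a) * f b + g a * (f b - g b).
    by rewrite mulrBl mulrBr addrA subrK addrC.
  rewrite (le_trans (cnormD _ _))// lerD//.
    by rewrite (le_trans (cnormM _ _))// ler_wpM2l ?cnorm_ge0 ?(usc_le fS).
  by rewrite (le_trans (cnormM _ _))// ler_wpM2r ?cnorm_ge0 ?(usc_le gS).
- move=> a b sa ab; have [fab fba] := usc_inverse fS ab.
  have [gab gba] := usc_inverse gS ab.
  have -> : f b - g b = f b * (g a - f a) * g b.
    by rewrite mulrBr mulrBl fba mul1r -mulrA gab mulr1.
  rewrite (le_trans (cnormM _ _))// cnorm_distC expr2 mulrAC.
  rewrite ler_pM ?cnorm_ge0 ?(usc_le gS)// (le_trans (cnormM _ _))// cnorm_distC.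
  by rewrite ler_wpM2r ?cnorm_ge0 ?(usc_le fS).
- exists 2 => // a; rewrite (le_trans (cnormB _ _))// mulr2n mulrDl !mul1r.
  by rewrite lerD ?(usc_le fS) ?(usc_le gS).
Qed.

End StronglyLeibnizSeminorms.

Lemma two_i (R : realType) : (2 * 'i : R[i])^-1 = (0 +i* - 2^-1)%C.
Proof.
apply: (mulIf (_ : (2 * 'i : R[i]) != 0)); first by rewrite mulf_neq0 ?pnatr_eq0 ?neq0Ci.
rewrite mulVf ?mulf_neq0 ?pnatr_eq0 ?neq0Ci//.
rewrite -complexiE -(rmorph_nat (real_complex R)).
by apply/eqP; rewrite eq_complex /=; apply/andP; split; apply/eqP; field.
Qed.

Section SupremumOfSeminorms.
Context {R : realType} (X : quantum_pair R) (I : Type) (d : I -> X -> R).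
Hypothesis d_sl : forall i, strongly_leibniz_seminorm (d i).
Hypothesis qdomP : forall a : X, qdom a <->
  selfadjoint a /\ exists K : R, forall i, d i a <= K.
Hypothesis qlip_ge0 : forall a : X, qdom a -> 0 <= qlip a.
Hypothesis qlipP : forall (a : X) (K : R), qdom a -> 0 <= K ->
  qlip a <= K <-> forall i, d i a <= K.
Implicit Types (a b : X) (K t : R).

Let d_le_qlip i a : qdom a -> d i a <= qlip a.
Proof. by move=> da; apply: (proj1 (qlipP da (qlip_ge0 da))). Qed.

Let qdomI a K : selfadjoint a -> (forall i, d i a <= K) -> qdom a.
Proof. by move=> sa dK; apply/qdomP; split => //; exists K. Qed.

Let sa_qdom a : qdom a -> star a = a.
Proof. by move=> /qdomP[]. Qed.

Lemma sl_jordan_le i a b K M : d i a <= K -> d i b <= M ->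
  d i (jordan_mul a b) <= K * cnorm b + cnorm a * M.
Proof.
move=> aK bM; rewrite (le_trans (slZ (d_sl i) _ _))//.
rewrite (_ : (2^-1 : R[i]) = (2^-1 : R)%:C); last first.
  by rewrite fmorphV rmorph_nat.
rewrite normc_real ger0_norm//.
have H1 := slD (d_sl i) (a * b) (b * a).
have H2 := slM (d_sl i) a b; have H3 := slM (d_sl i) b a.
have H4 : d i a * cnorm b <= K * cnorm b by rewrite ler_wpM2r ?cnorm_ge0.
have H5 : cnorm a * d i b <= cnorm a * M by rewrite ler_wpM2l ?cnorm_ge0.
by rewrite [d i b * _]mulrC [cnorm b * _]mulrC in H3; lra.
Qed.

Lemma sl_lie_le i a b K M : d i a <= K -> d i b <= M ->
  d i (lie_mul a b) <= K * cnorm b + cnorm a * M.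
Proof.
move=> aK bM; rewrite (le_trans (slZ (d_sl i) _ _))//.
rewrite two_i (_ : normc _ = 2^-1); last first.
  by rewrite /normc expr0n add0r sqrrN sqrtr_sqr ger0_norm.
have H1 := slD (d_sl i) (a * b) (- (b * a)).
have := slZ (d_sl i) (-1) (b * a); rewrite scaleN1r normcN normc1 mul1r => H0.
have H2 := slM (d_sl i) a b; have H3 := slM (d_sl i) b a.
have H4 : d i a * cnorm b <= K * cnorm b by rewrite ler_wpM2r ?cnorm_ge0.
have H5 : cnorm a * d i b <= cnorm a * M by rewrite ler_wpM2l ?cnorm_ge0.
by rewrite [d i b * _]mulrC [cnorm b * _]mulrC in H3; lra.
Qed.

Lemma selfadjoint_jordan a b : star a = a -> star b = b ->
  star (jordan_mul a b) = jordan_mul a b.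
Proof.
move=> sa sb; rewrite /jordan_mul starZc starD !starM sa sb addrC; congr (_ *: _).
by rewrite fmorphV rmorph_nat.
Qed.

Lemma selfadjoint_lie a b : star a = a -> star b = b ->
  star (lie_mul a b) = lie_mul a b.
Proof.
move=> sa sb; rewrite /lie_mul starZc starB !starM sa sb two_i -(opprB (a * b)).
rewrite scalerN -scaleNr; congr (_ *: _).
by apply/eqP; rewrite eq_complex /= !opprK oppr0 !eqxx.
Qed.

Lemma sup_jordan_lie : jordan_lie_subalgebra (@qdom R X).
Proof.
split.
- by move=> a /qdomP[].
- apply: (@qdomI _ 0); first exact: star0.
  by move=> i; have := slZ (d_sl i) 0 0; rewrite scale0r normc0 mul0r.
- move=> a b da db; apply: (@qdomI _ (qlip a + qlip b)) => [|i].
    by rewrite /selfadjoint /= starD !sa_qdom.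
  by rewrite (le_trans (slD (d_sl i) _ _))// lerD ?d_le_qlip.
- move=> t a da; apply: (@qdomI _ (`|t| * qlip a)) => [|i].
    by rewrite /selfadjoint /= starZR sa_qdom.
  rewrite (le_trans (slZ (d_sl i) _ _))// normc_real ler_wpM2l//.
  exact: d_le_qlip.
- move=> a b da db; split; apply: qdomI => [|i].
  + by apply: selfadjoint_jordan; exact: sa_qdom.
  + by apply: sl_jordan_le; exact: d_le_qlip.
  + by apply: selfadjoint_lie; exact: sa_qdom.
  + by apply: sl_lie_le; exact: d_le_qlip.
Qed.

Lemma sup_seminorm : seminorm_on (@qdom R X) (@qlip R X).
Proof.
have [_ _ dD dZ _] := sup_jordan_lie.
have LZ t a : qdom a -> qlip (t%:C *: a) <= `|t| * qlip a.
  move=> da; apply/qlipP; [exact: dZ|by rewrite mulr_ge0 ?qlip_ge0|] => i.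
  rewrite (le_trans (slZ (d_sl i) _ _))// normc_real ler_wpM2l//.
  exact: d_le_qlip.
split=> // [a b da db|t a da].
  apply/qlipP => [||i]; [exact: dD|by rewrite addr_ge0 ?qlip_ge0|].
  by rewrite (le_trans (slD (d_sl i) _ _))// lerD ?d_le_qlip.
(* The converse inequality is [LZ] for the scalar [t^-1] at [t%:C *: a]. *)
apply/eqP; rewrite eq_le LZ//=.
have [->|t0] := eqVneq t 0; first by rewrite normr0 mul0r qlip_ge0//; exact: dZ.
have := LZ t^-1 (t%:C *: a) (dZ _ _ da).
rewrite scalerA -rmorphM /= mulVf// scale1r => H.
have nt0 : 0 < `|t| by rewrite normr_gt0.
rewrite -(ler_pM2l (_ : 0 < `|t|^-1)) ?invr_gt0// mulrA mulVf ?gt_eqF// mul1r.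
by rewrite -normfV.
Qed.

Hypothesis qdom_dense : forall a, selfadjoint a -> forall e : R, 0 < e ->
  exists2 b, qdom b & cnorm (a - b) < e.
Hypothesis qlip_scalar : forall a, qdom a -> qlip a = 0 ->
  exists t, a = t%:C *: (1 : X).
Hypothesis qlip_approx : forall e : R, 0 < e -> exists (s : seq X) (C : R),
  0 <= C /\ forall a (phi psi : X -> R[i]), qdom a -> qlip a <= 1 ->
    state_space phi -> state_space psi ->
    normc (phi a - psi a) <= e + C * \sum_(x <- s) normc (phi x - psi x).

(** Upper bounds on [qlip] are accessed through [qlipP], so that the same statement serves a finite
    maximum, a supremum over all levels and the bridge seminorm; each inequality is tested member by
    member. *)
Theorem sup_strongly_leibniz_qcms : strongly_leibniz_qcms X.
Proof.
have JL := sup_jordan_lie; have SN := sup_seminorm.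
split; last first.
  move=> a b da ab; have sa := sa_qdom da.
  have sb : star b = b.
    case: (ab) => ab1 ba1; have : star b * a = 1 by rewrite -{1}sa -starM ab1 star1.
    by move=> H; rewrite -[LHS]mulr1 -ab1 mulrA H mul1r.
  have K0 : 0 <= cnorm b ^+ 2 * qlip a by rewrite mulr_ge0 ?sqr_ge0 ?qlip_ge0.
  have dK i : d i b <= cnorm b ^+ 2 * qlip a.
    rewrite (le_trans (slV (d_sl i) sa ab))// ler_wpM2l ?sqr_ge0//.
    exact: d_le_qlip.
  have db : qdom b by exact: qdomI dK.
  by split => //; apply/qlipP.
split.
- by split => // a /qdom_dense H; apply/closureP.
- apply/seteqP; split=> [a [da La]|_ [t _ <-]] /=.
    by have [t ->] := qlip_scalar da La; exists t.
  have dt i : d i (t%:C *: 1) <= 0.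
    by rewrite (le_trans (slZ (d_sl i) _ _))// sl1// mulr0.
  have qt : qdom (t%:C *: (1 : X)).
    by apply: qdomI dt; rewrite /selfadjoint /= starZR star1.
  by split => //; apply/eqP; rewrite eq_le qlip_ge0// andbT; apply/qlipP.
- exact: metrizes_mk.
- have [_ _ _ _ dM] := JL; move=> a b da db; have [dj dl] := dM _ _ da db.
  have K0 : 0 <= qlip a * cnorm b + cnorm a * qlip b.
    by rewrite addr_ge0 ?mulr_ge0 ?qlip_ge0 ?cnorm_ge0.
  rewrite ge_max; apply/andP; split; apply/qlipP => // i.
    by apply: sl_jordan_le; exact: d_le_qlip.
  by apply: sl_lie_le; exact: d_le_qlip.
- apply: closedP => a H.
  have sa : star a = a.
    apply/eqP; rewrite -subr_eq0; apply/eqP/cnorm_le_eq0 => e e0.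
    have [|b [db _] ab] := H (e / 2); first by rewrite divr_gt0.
    rewrite -(subrKA b) -{1}(sa_qdom db) -starB (le_trans (cnormD _ _))//.
    by rewrite cnorm_starE (cnorm_distC b) (splitr e) lerD// ltW.
  (* [qlip] itself need not be continuous; each [d i] is, so that each constraint [d i a <= 1]
     survives the limit. *)
  have da1 i : d i a <= 1.
    apply/ler_addgt0Pr => e e0; have [C C0 dC] := sl_bounded (d_sl i).
    have C10 : 0 < C + 1 by rewrite ltr_wpDl.
    have [|b [db Lb] ab] := H (e / (C + 1)); first by rewrite divr_gt0.
    rewrite -(subrK b a) addrC (le_trans (slD (d_sl i) _ _))// lerD//.
      by rewrite (le_trans (d_le_qlip i db)).
    rewrite (le_trans (dC _))// (le_trans (ler_wpM2l C0 (ltW ab)))//.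
    by rewrite mulrCA ler_piMr ?(ltW e0)// ler_pdivrMr// mul1r lerDl.
  have da : qdom a by exact: qdomI da1.
  by split => //; apply/qlipP.
Qed.

End SupremumOfSeminorms.

(** * Direct sums and tunnels *)

(** A named copy of the product, so that the C*-structure with the maximum norm is attached to it
    and not to every type of pairs. *)
Definition direct_sum (A B : Type) : Type := (A * B)%type.

Section DirectSum.
Context {R : realType} (A B : cstarType R).
Local Notation T := (direct_sum A B).

HB.instance Definition _ := GRing.Algebra.copy T (A * B)%type.

Let norm (p : T) : R := Num.max (cnorm p.1) (cnorm p.2).

Let norm1_le (p : T) : cnorm p.1 <= norm p.
Proof. by rewrite le_max lexx. Qed.

Let norm2_le (p : T) : cnorm p.2 <= norm p.
Proof. by rewrite le_max lexx orbT. Qed.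

Let normD (p q : T) : norm (p + q) <= norm p + norm q.
Proof.
by rewrite ge_max; apply/andP; split; rewrite (le_trans (cnormD _ _))// lerD.
Qed.

Let normZ (z : R[i]) (p : T) : norm (z *: p) = complex.Re `|z| * norm p.
Proof. by rewrite /norm !cnormZ maxr_pMr//; exact: normc_ge0. Qed.

Let norm_eq0 (p : T) : norm p = 0 -> p = 0.
Proof.
move=> p0; have := norm1_le p; have := norm2_le p; rewrite p0.
case: p {p0} => a b /= b0 a0; congr pair; apply: cnorm_eq0; apply/eqP.
  by rewrite eq_le a0 cnorm_ge0.
by rewrite eq_le b0 cnorm_ge0.
Qed.

Let norm_ge0 (p : T) : 0 <= norm p.
Proof. by rewrite le_max cnorm_ge0. Qed.

Let normM (p q : T) : norm (p * q) <= norm p * norm q.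
Proof.
rewrite ge_max; apply/andP.
by split; rewrite (le_trans (cnormM _ _))// ler_pM ?cnorm_ge0.
Qed.

Let dstar (p : T) : T := (star p.1, star p.2).

Let dstarK : involutive dstar.
Proof. by case=> a b; rewrite /dstar /= !starK. Qed.

Let dstarD : {morph dstar : p q / p + q}.
Proof. by move=> p q; rewrite /dstar /= !starD. Qed.

Let dstarZ (z : R[i]) (p : T) : dstar (z *: p) = z^* *: dstar p.
Proof. by rewrite /dstar /= !starZ. Qed.

Let dstarM (p q : T) : dstar (p * q) = dstar q * dstar p.
Proof. by rewrite /dstar /= !starM. Qed.

Let norm_dstar (p : T) : norm (dstar p * p) = norm p ^+ 2.
Proof.
rewrite /norm /= !cnorm_star; have [ab|ba] := leP (cnorm p.1) (cnorm p.2).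
  by apply/max_idPr; rewrite ler_pXn2r ?nnegrE ?cnorm_ge0.
by apply/max_idPl; rewrite ler_pXn2r ?nnegrE ?cnorm_ge0// ltW.
Qed.

HB.instance Definition _ := Algebra_isPreCStar.Build R T
  normD normZ norm_eq0 normM dstarK dstarD dstarZ dstarM norm_dstar.

Let cauchy_image (C : cstarType R) (f : T -> C) (F : set_system (normed T)) :
    (forall p q, cnorm (f p - f q) <= norm (p - q)) ->
  ProperFilter F -> cauchy F ->
  exists l : C, forall e : R, 0 < e -> F [set p | cnorm (l - f p) < e].
Proof.
move=> f_le FF cF; pose v (p : normed T) : normed C := f p.
have cG : cauchy (v @ F).
  apply/cauchy_ballP => e e0; move/cauchy_ballP: cF => /(_ e e0).
  rewrite !near2E /= => -[[P Q] [/= FP FQ] PQ].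
  exists (v @` P, v @` Q) => /=.
    by split => /=; [apply: filterS FP|apply: filterS FQ] => x Px; exists x.
  move=> [_ _] /= [[x Px <-] [y Qy <-]].
  have := PQ (x, y) (conj Px Qy); rewrite -!ball_normE /=; apply: le_lt_trans.
  by rewrite lecR; exact: f_le.
have /cvg_ex[l Gl] : cvg (v @ F) by exact: cauchy_normed_cvg.
exists l => e e0; have e0' : 0 < e%:C by rewrite ltcR.
move/cvgrPdist_lt: Gl => /(_ _ e0').
by apply: filterS => p; rewrite /= ltcR.
Qed.

Let dsum_complete (F : set_system (normed T)) : ProperFilter F -> cauchy F -> cvg F.
Proof.
move=> FF cF.
have [l1 H1] := @cauchy_image A (fun p => p.1) F (fun p q => norm1_le (p - q)) FF cF.
have [l2 H2] := @cauchy_image B (fun p => p.2) F (fun p q => norm2_le (p - q)) FF cF.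
apply/cvg_ex; exists ((l1, l2) : normed T); apply/cvgrPdist_lt => e e0.
have e0' : 0 < complex.Re e by move: e0; rewrite ltcE => /andP[].
apply: filterS (filterI (H1 _ e0') (H2 _ e0')) => p [/= p1 p2].
rewrite -(RRe_real (gtr0_real e0)) ltcR.
by rewrite gt_max p1.
Qed.

HB.instance Definition _ := PreCStar_isCStar.Build R T dsum_complete.

End DirectSum.

Section DirectSumProjections.
Context {R : realType} (A B : cstarType R).

Lemma cnorm_direct_sum (p : direct_sum A B) :
  cnorm p = Num.max (cnorm p.1) (cnorm p.2).
Proof. by []. Qed.

Lemma usc_fst : unital_star_contraction (fun p : direct_sum A B => p.1).
Proof. by split=> // p; rewrite cnorm_direct_sum le_max lexx. Qed.

Lemma usc_snd : unital_star_contraction (fun p : direct_sum A B => p.2).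
Proof. by split=> // p; rewrite cnorm_direct_sum le_max lexx orbT. Qed.

End DirectSumProjections.

Section UnitalStarContractions.
Context {R : realType}.

Lemma usc_val (A : cstarType R) (B : cstar_subalgebra A) :
  unital_star_contraction (val : subalg_type B -> A).
Proof. by []. Qed.

Lemma usc_comp (A B C : cstarType R) (g : B -> C) (f : A -> B) :
  unital_star_contraction g -> unital_star_contraction f ->
  unital_star_contraction (g \o f).
Proof.
move=> gS fS; split=> /=.
- split=> [z a b|a b|a] /=.
  + by rewrite (uscD fS) (uscZ fS) (uscD gS) (uscZ gS).
  + by rewrite (uscM fS) (uscM gS).
  + by rewrite (usc_star fS) (usc_star gS).
- by rewrite (usc1 fS) (usc1 gS).
- by move=> a; rewrite (le_trans (usc_le gS _)) ?(usc_le fS).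
Qed.

Lemma state_comp (A B : cstarType R) (f : A -> B) (phi : B -> R[i]) :
  star_morphism f -> f 1 = 1 -> state_space phi -> state_space (phi \o f).
Proof.
move=> [flin fM fstar] f1 Sphi; have [lin pos one] := Sphi; split=> [z a b|a|] /=.
- by rewrite flin lin.
- by rewrite fM fstar; exact: pos.
- by rewrite f1 one.
Qed.

End UnitalStarContractions.

Section Tunnels.
Context {R : realType}.
Implicit Types X Y D : quantum_pair R.

(** A lift that does not increase the seminorm attains the infimum. *)
Lemma quantum_isometry_of_lift X Y (f : X -> Y) : star_morphism f ->
  (forall b, exists a, f a = b) ->
  (forall a, qdom a -> qdom (f a) /\ qlip (f a) <= qlip a) ->
  (forall b, qdom b -> exists a, [/\ qdom a, f a = b & qlip a <= qlip b]) ->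
  quantum_isometry f.
Proof.
move=> fS fsurj fdom flift; split=> // [a /fdom[]//|b db].
apply/eqP; rewrite eq_le; apply/andP; split.
  by apply: le_ereal_inf_tmp => _ [a [/fdom[_ La] <-] <-]; rewrite lee_fin.
have [a [da fa La]] := flift b db.
by apply: (@le_trans _ _ (qlip a)%:E); [apply: ereal_inf_lbound; exists a|rewrite lee_fin].
Qed.

Lemma quantum_isometry1 X Y (f : X -> Y) : quantum_isometry f -> f 1 = 1.
Proof.
move=> [[_ fM _] fsurj _ _]; have [a fa] := fsurj 1.
by rewrite -[LHS]mulr1 -fa -fM mul1r fa.
Qed.

Lemma monge_kantorovich_ge0 D (phi psi : D -> R[i]) :
  quantum_compact_metric_space D -> (0 <= monge_kantorovich phi psi)%E.
Proof. by move=> [[jl _ sn] _ _ _ _]; exact: mk_ge0. Qed.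

Lemma hausdorff_distance_ge0 (T : Type) (d : T -> T -> \bar R) (P Q : set T) :
  (forall x y, (0 <= d x y)%E) -> P !=set0 -> (0 <= hausdorff_distance d P Q)%E.
Proof.
move=> d0 [x Px]; rewrite le_max; apply/orP; left.
apply: (@le_trans _ _ (ereal_inf [set d x y | y in Q])).
  by apply: le_ereal_inf_tmp => _ [y _ <-].
by apply: ereal_sup_ubound; exists x.
Qed.

Lemma tunnel_extent_ge0 X1 X2 D (p1 : D -> X1) (p2 : D -> X2) :
  (state_space : set (X1 -> R[i])) !=set0 -> tunnel p1 p2 ->
  (0 <= tunnel_extent p1 p2)%E.
Proof.
move=> [phi Sphi] [Dq p1i _]; rewrite le_max; apply/orP; left.
apply: hausdorff_distance_ge0; first by move=> *; exact: monge_kantorovich_ge0.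
have [p1S _ _ _] := p1i; exists (phi \o p1).
exact: state_comp p1S (quantum_isometry1 p1i) Sphi.
Qed.

(** A supremum over an empty set of states would be [-oo], whence the need for a state. This is the
    lower bound used to squeeze the limit. *)
Lemma dual_propinquity_SL_ge0 X1 X2 : (state_space : set (X1 -> R[i])) !=set0 ->
  (0 <= dual_propinquity_SL X1 X2)%E.
Proof.
move=> S1; apply: le_ereal_inf_tmp => _ [D [p1 [p2 [tun _ ->]]]].
exact: tunnel_extent_ge0.
Qed.

(** Since [phi \o p] is itself a state of [D], one half of the Hausdorff distance is at most 0; what
    remains is to approximate each state of [D]. *)
Lemma hausdorff_states_le X D (p : D -> X) (r : R) : 0 <= r ->
  quantum_isometry p ->
  (forall mu, state_space mu -> exists2 phi, state_space phi &
     forall a, qdom a -> qlip a <= 1 -> normc (mu a - phi (p a)) <= r) ->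
  (hausdorff_distance (@monge_kantorovich R D) state_space
     [set phi \o p | phi in state_space] <= r%:E)%E.
Proof.
move=> r0 pi H; have [pS _ _ _] := pi.
rewrite ge_max; apply/andP; split; apply: ge_ereal_sup.
  move=> _ [mu /H[phi Sphi Hphi] <-].
  apply: (@le_trans _ _ (monge_kantorovich mu (phi \o p))).
    by apply: ereal_inf_lbound; exists (phi \o p) => //; exists phi.
  by apply: ge_ereal_sup => _ [a [da La] <-]; rewrite lee_fin; exact: Hphi.
move=> _ [_ [phi Sphi <-] <-].
apply: (@le_trans _ _ (monge_kantorovich (phi \o p) (phi \o p))).
  apply: ereal_inf_lbound; exists (phi \o p) => //.
  exact: state_comp pS (quantum_isometry1 pi) Sphi.
apply: ge_ereal_sup => _ [a _ <-]; rewrite lee_fin subrr.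
by rewrite -[complex.Re _]/(normc 0) normc0.
Qed.

End Tunnels.

(** * The Frobenius-Rieffel seminorm on the limit *)

Section FrobeniusRieffelTower.
Context {R : realType} {A : cstarType R}.
Variable tau : {scalar A}.
Hypothesis tau_ge0 : forall a, 0 <= tau (star a * a).
Hypothesis tau1 : tau 1 = 1.
Hypothesis tau_faithful : faithful tau.
Variables (U : nat -> cstar_subalgebra A) (E : nat -> A -> A) (beta kappa : nat -> R).
Hypothesis U_mono : forall n, U n `<=` U n.+1.
Hypothesis U_fin : forall n, finite_dimensional (U n).
Hypothesis U_0 : U 0%N = [set z *: (1 : A) | z in [set: R[i]]] :> set A.
Hypothesis U_dense : closure ((\bigcup_n U n) : set (normed A)) = setT.
Hypothesis beta_gt0 : forall n, 0 < beta n.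
Hypothesis E_cond : forall n, conditional_expectation (U n) (E n).
Hypothesis tauE : forall n, tau \o E n = tau.
Hypothesis kappa_gt0 : forall n, 0 < kappa n.
Hypothesis kappa_le : forall n a, subalg_set (U n.+1) a ->
  kappa n * cnorm a <= frobenius_rieffel_norm (E n) a.
Variable tail : nat -> R.
Hypothesis tail_gt0 : forall n, 0 < tail n.
Hypothesis tail_ub : forall n N, \sum_(n <= j < N) beta j <= tail n.
Hypothesis tail_small : forall e : R, 0 < e -> exists N, tail N < e.
Implicit Types (a b : A) (m n N : nat) (K : R).

Definition fr_seminorm m a : R := deviation (E m) a / (kappa m * beta m).

Definition fr_dom : set A :=
  [set a | selfadjoint a /\ exists K, forall m, fr_seminorm m a <= K].

(** [sup] is 0 on an unbounded set, a case that does not occur on [fr_dom]. *)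
Definition fr_lip a : R := sup (range (fr_seminorm ^~ a)).

Let w_gt0 m : 0 < kappa m * beta m.
Proof. exact: mulr_gt0. Qed.

Lemma U_le m n : (m <= n)%N -> U m `<=` U n.
Proof.
move=> /subnK <-; elim: (n - m)%N => [//|k IHk] a /IHk.
by rewrite addSn; exact: U_mono.
Qed.

Lemma fr_seminorm_sl m : strongly_leibniz_seminorm (fr_seminorm m).
Proof.
apply: sl_scale; first by rewrite invr_ge0 ltW.
have Um := U_fin m; have Em := E_cond m; have tEm := tauE m; split.
- exact: (deviationD tau_ge0 tau1 tau_faithful Um Em tEm).
- exact: (deviationZ_le tau_ge0 tau1 tau_faithful Um Em tEm).
- apply: (deviation_in tau_ge0 tau1 tau_faithful Um Em tEm); exact: subalg1.
- exact: (deviationM tau_ge0 tau1 tau_faithful Um Em tEm).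
- exact: (deviationV tau_ge0 tau1 tau_faithful Um Em tEm).
- exists 1 => // a; rewrite mul1r.
  exact: (deviation_le_cnorm tau_ge0 tau1 tau_faithful Um Em tEm).
Qed.

Lemma fr_seminorm_ge0 m a : 0 <= fr_seminorm m a.
Proof. exact: sl_ge0 (fr_seminorm_sl m). Qed.

Lemma fr_seminorm_in m n a : (n <= m)%N -> subalg_set (U n) a -> fr_seminorm m a = 0.
Proof.
move=> /U_le nm /nm Ua; rewrite /fr_seminorm.
by rewrite (deviation_in tau_ge0 tau1 tau_faithful (U_fin m) (E_cond m) (tauE m) Ua) mul0r.
Qed.

Lemma fr_seminorm_condexp m n a : fr_seminorm m (E n a) <= fr_seminorm m a.
Proof.
have [nm|/ltnW mn] := leqP n m.
  by rewrite (fr_seminorm_in nm) ?fr_seminorm_ge0//; exact: (condexp_in (E_cond n)).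
rewrite /fr_seminorm ler_wpM2r ?invr_ge0 ?(ltW (w_gt0 m))//.
by apply: (deviation_condexp_le tau_ge0 tau1 tau_faithful (U_fin m) (E_cond m)
  (E_cond n) (tauE m) (tauE n)); exact: U_le.
Qed.

Lemma fr_lip_le a K : fr_dom a -> fr_lip a <= K <-> forall m, fr_seminorm m a <= K.
Proof.
move=> [_ [M aM]]; split=> [aK m|aK].
  apply: le_trans aK; apply: ub_le_sup; last by exists m.
  by exists M => _ [k _ <-].
by apply: ge_sup => [|_ [k _ <-]//]; exists (fr_seminorm 0 a); exists 0%N.
Qed.

Lemma fr_lip_ge0 a : fr_dom a -> 0 <= fr_lip a.
Proof.
move=> da; apply: (le_trans (fr_seminorm_ge0 0 a)).
exact: (proj1 (fr_lip_le _ da) (lexx _)).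
Qed.

Lemma fr_dom_in n a : selfadjoint a -> subalg_set (U n) a -> fr_dom a.
Proof.
move=> sa Ua; split => //; exists (\sum_(k < n) fr_seminorm k a) => m.
have [nm|mn] := leqP n m.
  by rewrite (fr_seminorm_in nm Ua) sumr_ge0// => k _; exact: fr_seminorm_ge0.
rewrite (bigD1 (Ordinal mn)) //= lerDl sumr_ge0// => k _.
exact: fr_seminorm_ge0.
Qed.

(** Levels [m >= n] vanish on [U n], and for self-adjoint [a] the two terms of each maximum agree,
    so that the finite maximum is the supremum over all levels. *)
Lemma frobenius_rieffel_lip_le n a K : star a = a -> subalg_set (U n) a -> 0 <= K ->
  frobenius_rieffel_lip E kappa beta n a <= K <-> forall m, fr_seminorm m a <= K.
Proof.
move=> sa Ua K0; rewrite /frobenius_rieffel_lip sa.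
split=> [aK m|aK].
  have [nm|mn] := leqP n m; first by rewrite (fr_seminorm_in nm Ua).
  apply: le_trans aK; apply: le_trans (le_bigmax _ _ (Ordinal mn)) => /=.
  by rewrite maxxx.
by apply: bigmax_le => // m _; rewrite maxxx; exact: aK.
Qed.

Lemma frobenius_rieffel_lip_ge0 n a : 0 <= frobenius_rieffel_lip E kappa beta n a.
Proof.
rewrite /frobenius_rieffel_lip.
elim/big_ind: _ => // [x y x0 y0|m _]; first by rewrite le_max x0.
by rewrite divr_ge0 ?(ltW (w_gt0 m))// le_max frobenius_rieffel_ge0.
Qed.

(** For [b = E n.+1 a] the tower property turns [b - E n a] into [b - E n b], an element of [U n.+1]
    to which [kappa_le] applies; then [kappa n] cancels against the weight [kappa n * beta n]. *)
Lemma condexp_step n a K : 0 <= K -> (forall m, fr_seminorm m a <= K) ->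
  cnorm (E n.+1 a - E n a) <= K * beta n.
Proof.
move=> K0 aK; rewrite -(ler_pM2l (kappa_gt0 n)).
have En1 := condexp_in (E_cond n.+1) a.
have En := U_mono (condexp_in (E_cond n) a).
rewrite (le_trans (kappa_le (subalgB En1 En)))//.
have <- := condexp_tower tau_faithful (E_cond n) (E_cond n.+1) (tauE n) (tauE n.+1)
  (U_mono (n := n)) a.
have := le_trans (fr_seminorm_condexp n n.+1 a) (aK n).
by rewrite ler_pdivrMr// mulrCA.
Qed.

(** [E N] fixes an approximant [b] in [U N], so that [a - E N a = (a - b) - E N (a - b)]. The
    condition [n <= N] is for the telescoping sum. *)
Lemma condexp_cvg a (e : R) n : 0 < e ->
  exists2 N, (n <= N)%N & cnorm (a - E N a) <= e.
Proof.
move=> e0; have e20 : 0 < e / 2 by rewrite divr_gt0.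
have [|b [M _ Ub] ab] := proj1 (closureP (\bigcup_n U n) a) _ _ e20.
  by rewrite U_dense.
exists (maxn n M); first exact: leq_maxl.
set N := maxn n M; have UNb : subalg_set (U N) b by apply: U_le Ub; exact: leq_maxr.
have -> : a - E N a = (a - b) - E N (a - b).
  by rewrite (condexpB (E_cond N)) (condexp_id (E_cond N) UNb) opprB addrA subrK.
rewrite (le_trans (cnormB _ _))// (splitr e) lerD ?(ltW ab)//.
by rewrite (le_trans (condexp_le (E_cond N) _)) ?ltW.
Qed.

Lemma fr_tail n a K : 0 <= K -> (forall m, fr_seminorm m a <= K) ->
  cnorm (a - E n a) <= K * tail n.
Proof.
move=> K0 aK; apply/ler_addgt0Pr => e e0; have [N nN aN] := condexp_cvg a n e0.
rewrite -(subrKA (E N a)) addrC (le_trans (cnormD _ _))// lerD//.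
apply: (@le_trans _ _ (K * \sum_(n <= j < N) beta j)); last by rewrite ler_wpM2l.
rewrite -(telescope_sumr (fun k => E k a) nN) (le_trans (cnorm_sum _ _))//.
by rewrite mulr_sumr ler_sum// => j _; exact: condexp_step.
Qed.

Lemma fr_tail1 n a : (forall m, fr_seminorm m a <= 1) -> cnorm (a - E n a) <= tail n.
Proof. by move=> /(fr_tail n ler01); rewrite mul1r. Qed.

Lemma E0_scalar a : exists z, E 0 a = z *: 1.
Proof.
have := condexp_in (E_cond 0) a; rewrite -[subalg_set _ _]/((U 0%N : set A) _) U_0.
by move=> [z _ <-]; exists z.
Qed.

Lemma E0_real a : star a = a -> exists t : R, E 0 a = t%:C *: 1.
Proof.
move=> sa; have [z zE] := E0_scalar a.
have := condexp_star tau_ge0 tau_faithful (E_cond 0) (tauE 0) a.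
rewrite sa zE starZc star1 => /eqP; rewrite -subr_eq0 -scalerBl => /eqP zz.
have : normc (z - z^*%C) * 1 = 0 by rewrite -(@cnorm1 R A) -cnormZc zz cnorm0.
rewrite mulr1 => /eq0_normc zJ; exists (complex.Re z); congr (_ *: _).
by case: z zJ {zE zz} => u v [_ H] /=; congr (_ +i* _)%C; lra.
Qed.

Lemma fr_seminorm_eq0 a : star a = a -> (forall m, fr_seminorm m a <= 0) ->
  exists t : R, a = t%:C *: 1.
Proof.
move=> sa a0; have [t tE] := E0_real sa; exists t; rewrite -tE.
apply/eqP; rewrite -subr_eq0; apply/eqP/cnorm_le_eq0 => e /ltW; apply: le_trans.
by have := fr_tail 0 (lexx 0) a0; rewrite mul0r.
Qed.

Lemma fr_dense a : star a = a -> forall e : R, 0 < e ->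
  exists2 b, fr_dom b & cnorm (a - b) < e.
Proof.
move=> sa e e0; have e20 : 0 < e / 2 by rewrite divr_gt0.
have [N _ aN] := condexp_cvg a 0 e20; exists (E N a).
  apply: (@fr_dom_in N); last exact: (condexp_in (E_cond N)).
  rewrite /selfadjoint /= -(condexp_star tau_ge0 tau_faithful (E_cond N) (tauE N)).
  by rewrite sa.
by rewrite (le_lt_trans aN)// ltr_pdivrMr// ltr_pMr// ltr1n.
Qed.

(** Expansion along a Gram-Schmidt basis: by Cauchy-Schwarz the coefficient at [x] is at most
    [N2 x * cnorm b]. *)
Lemma subalg_functional_bound n : exists (s : seq (subalg_type (U n))) (C : R),
  0 <= C /\ forall f : subalg_type (U n) -> R[i], scalar f ->
    forall b : subalg_type (U n), normc (f b) <= C * cnorm b * \sum_(x <- s) normc (f x).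
Proof.
have [e [eU eP]] := gns_orthonormal_basis tau_ge0 tau_faithful (U_fin n).
pose lift (x : A) : subalg_type (U n) := insubd 0 x.
have liftE x : x \in e -> val (lift x) = x.
  by move=> /eU Ux; apply: insubdK; apply/asboolP.
exists [seq lift x | x <- e], (\sum_(x <- e) gns_norm tau x); split.
  by rewrite sumr_ge0// => x _; exact: gns_norm_ge0.
move=> f flin b.
have [g gE] : exists g : {scalar (subalg_type (U n))}, g = f :> (_ -> _).
  pose g : {scalar (subalg_type (U n))} :=
    HB.pack f (GRing.isLinear.Build R[i] (subalg_type (U n)) R[i] _ f flin).
  by exists g.
have bE : b = \sum_(x <- e) tau (star x * val b) *: lift x.
  apply: val_inj; rewrite raddf_sum /=.
  rewrite {1}(eP (val b)); last exact/asboolP/(valP b).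
  by apply: eq_big_seq => x xe; rewrite -[X in _ *: X]liftE.
rewrite {1}bE -gE linear_sum /= big_map mulr_sumr big_seq [leRHS]big_seq.
have normc_sum (I : Type) (r : seq I) (P : pred I) (F : I -> R[i]) :
    normc (\sum_(i <- r | P i) F i) <= \sum_(i <- r | P i) normc (F i).
  elim/big_ind2: _ => [|u s v t us vt|//]; first by rewrite normc0.
  by rewrite (le_trans (le_normcD _ _))// lerD.
rewrite (le_trans (normc_sum _ _ _ _))// ler_sum// => x xe.
rewrite linearZ /= normcM ler_wpM2r ?normc_ge0//.
rewrite (le_trans (gns_Cauchy_Schwarz tau_ge0 _ _))//.
rewrite ler_pM ?gns_norm_ge0//.
  rewrite (big_rem x)//= lerDl sumr_ge0// => y _; exact: gns_norm_ge0.
rewrite -[val b]mulr1 (le_trans (gns_normM tau_ge0 _ _))//.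
by rewrite gns_norm1// mulr1.
Qed.

(** Total boundedness in dual form: [a] is cut at a level [N] with [tail N < e / 2]. The model for
    [f] is a difference of states, whence the factor 2; it is an arbitrary functional with that
    bound because the restriction to a summand of a state of the direct sum need not be a state. *)
Lemma fr_functional_bound (e : R) : 0 < e -> exists (s : seq A) (C : R), 0 <= C /\
  forall (f : A -> R[i]) a, scalar f -> (forall x, normc (f x) <= 2 * cnorm x) ->
    (forall m, fr_seminorm m a <= 1) ->
    normc (f (a - E 0 a)) <= e + C * \sum_(x <- s) normc (f x).
Proof.
move=> e0; have [N Ne] := tail_small (divr_gt0 e0 (ltr0Sn R 1)).
have [s [C [C0 sC]]] := subalg_functional_bound N.
exists [seq val x | x <- s], (C * tail 0); split=> [|f a flin f2 aK].
  by rewrite mulr_ge0// ltW.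
have inN : E N a - E 0 a \in subalg_pred (U N).
  apply/asboolP/subalgB; first exact: (condexp_in (E_cond N)).
  exact: (U_le (leq0n N)) (condexp_in (E_cond 0) a).
have flin' : scalar (f \o (val : subalg_type (U N) -> A)).
  by move=> z x y /=; rewrite flin.
have -> : a - E 0 a = 1 *: (a - E N a) + (E N a - E 0 a).
  by rewrite scale1r addrA subrK.
rewrite flin mul1r (le_trans (le_normcD _ _))// lerD//.
  rewrite (le_trans (f2 _))// mulrC -ler_pdivlMr//.
  by rewrite (le_trans (fr_tail1 N aK)) ?ltW.
have /= := sC _ flin' (SubalgElt inN); rewrite big_map => /le_trans; apply.
rewrite ler_wpM2r ?sumr_ge0// => [x _|]; first exact: normc_ge0.
rewrite ler_wpM2l//.
have -> : cnorm (SubalgElt inN) = cnorm (E N a - E 0 a) by [].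
(* The contraction [E N] reduces the estimate to [cnorm (a - E 0 a) <= tail 0]. *)
have -> : E N a - E 0 a = E N (a - E 0 a).
  rewrite (condexpB (E_cond N)) [E N (E 0 a)](condexp_id (E_cond N))//.
  exact: (U_le (leq0n N)) (condexp_in (E_cond 0) a).
by rewrite (le_trans (condexp_le (E_cond N) _)) ?fr_tail1.
Qed.

Lemma state_diff_scalar (X : cstarType R) (V : lmodType R[i]) (g : V -> X)
    (phi psi : X -> R[i]) : linear g -> state_space phi -> state_space psi ->
  scalar (fun v => phi (g v) - psi (g v)).
Proof.
move=> glin [philin _ _] [psilin _ _] z u v /=.
by rewrite glin philin psilin; ring.
Qed.

Lemma state_diff_le (X : cstarType R) (phi psi : X -> R[i]) x :
  state_space phi -> state_space psi -> normc (phi x - psi x) <= 2 * cnorm x.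
Proof.
move=> Sphi Spsi; rewrite (le_trans (le_normcD _ _))// normcN mulr2n mulrDl !mul1r.
by rewrite lerD ?state_normc_le.
Qed.

Lemma state_diff_sub1 (X : cstarType R) (phi psi : X -> R[i]) x z :
  state_space phi -> state_space psi ->
  phi x - psi x = phi (x - z *: 1) - psi (x - z *: 1).
Proof.
move=> Sphi Spsi; rewrite (stateB _ _ Sphi) (stateB _ _ Spsi).
rewrite (stateZ _ _ Sphi) (stateZ _ _ Spsi).
by case: Sphi => _ _ ->; case: Spsi => _ _ ->; ring.
Qed.

Theorem fr_limit_qcms : strongly_leibniz_qcms (QuantumPair fr_dom fr_lip).
Proof.
apply: (@sup_strongly_leibniz_qcms R (QuantumPair fr_dom fr_lip) nat fr_seminorm) => /=.
- exact: fr_seminorm_sl.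
- by [].
- exact: fr_lip_ge0.
- by move=> a K da _; exact: fr_lip_le.
- exact: fr_dense.
- move=> a da La; have [sa _] := da; apply: fr_seminorm_eq0 => //.
  by apply/fr_lip_le; rewrite // La.
- move=> e /fr_functional_bound[s [C [C0 sC]]]; exists s, C; split=> //.
  move=> a phi psi da La Sphi Spsi; have [z zE] := E0_scalar a.
  rewrite (state_diff_sub1 _ z Sphi Spsi) -zE.
  apply: (sC (fun x => phi x - psi x)) => [|x|].
  + exact: (state_diff_scalar (g := id)).
  + exact: state_diff_le.
  + exact/fr_lip_le.
Qed.

Theorem fr_space_qcms n :
  strongly_leibniz_qcms (frobenius_rieffel_space E kappa beta U n).
Proof.
have inU (x : subalg_type (U n)) : subalg_set (U n) (val x) by exact/asboolP/(valP x).
have sa_val (x : subalg_type (U n)) : selfadjoint x -> star (val x) = val x.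
  by move=> sx; rewrite -[RHS](congr1 val sx).
have lipP (x : subalg_type (U n)) K : selfadjoint x -> 0 <= K ->
    frobenius_rieffel_lip E kappa beta n (val x) <= K <->
    forall m, fr_seminorm m (val x) <= K.
  by move=> sx K0; apply: frobenius_rieffel_lip_le => //; exact: sa_val.
apply: (@sup_strongly_leibniz_qcms R (frobenius_rieffel_space E kappa beta U n) nat
  (fun m (x : subalg_type (U n)) => fr_seminorm m (val x))) => /=.
- by move=> m; exact: (sl_comp (usc_val (U n)) (fr_seminorm_sl m)).
- move=> x; split=> [sx|[]//]; split => //.
  by have [_] := fr_dom_in (sa_val _ sx) (inU x).
- by move=> x _; exact: frobenius_rieffel_lip_ge0.
- by move=> x K sx K0; exact: lipP.
- by move=> x sx e e0; exists x; rewrite // subrr cnorm0.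
- move=> x sx Lx; have [|t tE] := @fr_seminorm_eq0 (val x) (sa_val _ sx).
    by apply/lipP; rewrite // -Lx.
  by exists t; apply: val_inj.
- move=> e e0; have [s [C [C0 sC]]] := subalg_functional_bound n.
  exists s, (C * tail 0); split; first by rewrite mulr_ge0// ltW.
  move=> x phi psi sx Lx Sphi Spsi; have [z zE] := E0_scalar (val x).
  rewrite (state_diff_sub1 _ z Sphi Spsi).
  apply: le_trans (sC _ (state_diff_scalar (g := id) _ Sphi Spsi) _) _ => //.
  rewrite -[leLHS]add0r lerD ?(ltW e0)// ler_wpM2r//.
    by rewrite sumr_ge0// => y _; exact: normc_ge0.
  rewrite ler_wpM2l//.
  have -> : cnorm (x - z *: 1) = cnorm (val x - E 0 (val x)) by rewrite zE.
  by apply: fr_tail1; apply/lipP.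
Qed.

(** * The tunnel between [U n] and the limit *)

Section Tunnel.
Variable n : nat.
Local Notation Un := (subalg_type (U n)).
Local Notation Un_space := (frobenius_rieffel_space E kappa beta U n).
Local Notation A_space := (QuantumPair fr_dom fr_lip).

Definition bridge_dom : set (direct_sum Un A) :=
  [set p | selfadjoint p.1 /\ fr_dom p.2].

Definition bridge_lip (p : direct_sum Un A) : R :=
  Num.max (Num.max (frobenius_rieffel_lip E kappa beta n (val p.1)) (fr_lip p.2))
          (cnorm (val p.1 - p.2) / tail n).

Definition bridge_space : quantum_pair R :=
  @QuantumPair R (direct_sum Un A) bridge_dom bridge_lip.

(** The seminorms of both summands and the bridge term as a single family, the form in which the
    statement on suprema applies; [None] is the bridge term. *)
Definition bridge_seminorm (i : option (bool * nat)) (p : direct_sum Un A) : R :=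
  match i with
  | None => cnorm (val p.1 - p.2) / tail n
  | Some (true, m) => fr_seminorm m (val p.1)
  | Some (false, m) => fr_seminorm m p.2
  end.

Let inU (x : Un) : subalg_set (U n) (val x).
Proof. exact/asboolP/(valP x). Qed.

Let sa_val (x : Un) : selfadjoint x -> star (val x) = val x.
Proof. by move=> sx; rewrite -[RHS](congr1 val sx). Qed.

Let usc_val1 : unital_star_contraction (fun p : direct_sum Un A => val p.1).
Proof. exact: (usc_comp (usc_val (U n)) (usc_fst _ _)). Qed.

Let usc_val2 : unital_star_contraction (fun p : direct_sum Un A => p.2).
Proof. exact: usc_snd. Qed.

Lemma bridge_seminorm_sl i : strongly_leibniz_seminorm (bridge_seminorm i).
Proof.
case: i => [[[] m]|].
- exact: (sl_comp usc_val1 (fr_seminorm_sl m)).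
- exact: (sl_comp usc_val2 (fr_seminorm_sl m)).
- apply: sl_scale; first by rewrite invr_ge0 ltW.
  exact: (sl_distance usc_val1 usc_val2).
Qed.

Lemma bridge_lip_le p K : bridge_dom p -> 0 <= K ->
  bridge_lip p <= K <->
  [/\ frobenius_rieffel_lip E kappa beta n (val p.1) <= K, fr_lip p.2 <= K
    & cnorm (val p.1 - p.2) <= K * tail n].
Proof.
move=> [s1 d2] K0; rewrite !ge_max ler_pdivrMr//.
by split=> [/andP[/andP[]]|[-> -> ->]].
Qed.

Lemma bridge_lipP p K : bridge_dom p -> 0 <= K ->
  bridge_lip p <= K <-> forall i, bridge_seminorm i p <= K.
Proof.
move=> dp K0; have [s1 d2] := dp.
have L1 := frobenius_rieffel_lip_le (sa_val s1) (inU p.1) K0.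
have L2 := fr_lip_le K d2.
split=> [/(bridge_lip_le dp K0)[H1 H2 H3] [[[] m]|]|H] /=.
- exact: (proj1 L1).
- exact: (proj1 L2).
- by rewrite ler_pdivrMr.
- apply/(bridge_lip_le dp K0); split.
  + by apply: (proj2 L1) => m; exact: (H (Some (true, m))).
  + by apply: (proj2 L2) => m; exact: (H (Some (false, m))).
  + by have := H None; rewrite /= ler_pdivrMr.
Qed.

Lemma bridge_domP p : bridge_dom p <->
  selfadjoint p /\ exists K, forall i, bridge_seminorm i p <= K.
Proof.
split=> [dp|[sp [K pK]]].
  have [s1 [s2 _]] := dp; split.
    by case: p s1 s2 {dp} => b a /= s1 s2; rewrite /selfadjoint /=; congr pair.
  have L0 : 0 <= Num.max 0 (bridge_lip p) by rewrite le_max lexx.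
  exists (Num.max 0 (bridge_lip p)); apply/bridge_lipP => //.
  by rewrite le_max lexx orbT.
split; first exact: (congr1 fst sp).
split; first exact: (congr1 snd sp).
by exists K => m; exact: (pK (Some (false, m))).
Qed.

Lemma bridge_lip_ge0 p : 0 <= bridge_lip p.
Proof. by rewrite le_max divr_ge0 ?cnorm_ge0 ?(ltW (tail_gt0 n))// orbT. Qed.

(** The scalar [E 0 p.2] is subtracted from both coordinates, which a difference of states does not
    detect. The second coordinate then falls under the bound for the limit, and the first lies in
    finite dimension with norm at most [tail n + tail 0]. *)
Lemma bridge_functional_bound (e : R) : 0 < e ->
  exists (s : seq (direct_sum Un A)) (C : R), 0 <= C /\
  forall p (phi psi : direct_sum Un A -> R[i]), bridge_dom p -> bridge_lip p <= 1 ->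
    state_space phi -> state_space psi ->
    normc (phi p - psi p) <= e + C * \sum_(x <- s) normc (phi x - psi x).
Proof.
move=> /fr_functional_bound[s [C [C0 sC]]].
have [t [M [M0 tM]]] := subalg_functional_bound n.
pose i1 (x : Un) : direct_sum Un A := (x, 0).
pose i2 (x : A) : direct_sum Un A := (0, x).
have i1lin : linear i1 by move=> z x y; rewrite /i1; congr pair; rewrite /= scaler0 addr0.
have i2lin : linear i2 by move=> z x y; rewrite /i2; congr pair; rewrite /= scaler0 addr0.
have T0 : 0 <= tail n + tail 0 by rewrite addr_ge0 ?(ltW (tail_gt0 _)).
exists ([seq i1 x | x <- t] ++ [seq i2 x | x <- s]), (M * (tail n + tail 0) + C).
split; first by rewrite addr_ge0 ?mulr_ge0.
move=> p phi psi dp /(bridge_lip_le dp ler01)[_ L2 p12] Sphi Spsi.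
have {}L2 := proj1 (fr_lip_le _ dp.2) L2; rewrite mul1r in p12.
have [z zE] := E0_scalar p.2.
rewrite (state_diff_sub1 _ z Sphi Spsi).
have -> : p - z *: 1 = i1 (p.1 - z *: 1) + i2 (p.2 - E 0 p.2).
  by rewrite zE /i1 /i2; case: (p) => b a; congr pair; rewrite /= ?addr0 ?add0r.
rewrite (stateD _ _ Sphi) (stateD _ _ Spsi) opprD addrACA.
rewrite (le_trans (le_normcD _ _))// big_cat /= !big_map.
set S1 := \sum_(x <- t) _; set S2 := \sum_(x <- s) _.
have S10 : 0 <= S1 by rewrite sumr_ge0// => x _; exact: normc_ge0.
have S20 : 0 <= S2 by rewrite sumr_ge0// => x _; exact: normc_ge0.
have H1 := tM _ (state_diff_scalar i1lin Sphi Spsi) (p.1 - z *: 1).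
have H2 : normc (phi (i2 (p.2 - E 0 p.2)) - psi (i2 (p.2 - E 0 p.2))) <= e + C * S2.
  apply: (sC (fun x => phi (i2 x) - psi (i2 x))) => [|x|//].
    exact: state_diff_scalar.
  rewrite (le_trans (state_diff_le _ Sphi Spsi))// ler_wpM2l//.
  by rewrite cnorm_direct_sum /= cnorm0 ge_max cnorm_ge0 lexx.
have H3 : cnorm (p.1 - z *: 1) <= tail n + tail 0.
  have -> : cnorm (p.1 - z *: 1) = cnorm ((val p.1 - p.2) + (p.2 - E 0 p.2)).
    by rewrite zE addrA subrK.
  by rewrite (le_trans (cnormD _ _))// lerD// fr_tail1.
have H4 : M * cnorm (p.1 - z *: 1) * S1 <= M * (tail n + tail 0) * S1.
  by rewrite ler_wpM2r// ler_wpM2l.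
have H5 : 0 <= C * S1 by rewrite mulr_ge0.
have H6 : 0 <= M * (tail n + tail 0) * S2 by rewrite !mulr_ge0.
rewrite (le_trans (lerD (le_trans H1 H4) H2))//.
by move: H5 H6; rewrite -/S1; lra.
Qed.

Lemma bridge_qcms : strongly_leibniz_qcms bridge_space.
Proof.
apply: (@sup_strongly_leibniz_qcms R bridge_space _ bridge_seminorm) => /=.
- exact: bridge_seminorm_sl.
- exact: bridge_domP.
- by move=> p _; exact: bridge_lip_ge0.
- exact: bridge_lipP.
- move=> p sp e e0; have [b db pb] := fr_dense (congr1 snd sp) e0.
  exists (p.1, b); first by split => //; exact: (congr1 fst sp).
  by rewrite cnorm_direct_sum /= subrr cnorm0 gt_max e0.
- move=> p dp Lp; have := bridge_lip_le dp (lexx 0).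
  rewrite Lp lexx mul0r => -[/(_ isT)[_ L2 p12] _].
  have [t tE] := fr_seminorm_eq0 dp.2.1 (proj1 (fr_lip_le _ dp.2) L2).
  exists t; case: p p12 tE {dp Lp L2} => b a /= p12 aE; rewrite aE in p12 *.
  congr pair; apply: val_inj; apply/eqP; rewrite -subr_eq0; apply/eqP/cnorm_eq0.
  by apply/eqP; rewrite eq_le cnorm_ge0 andbT.
- exact: bridge_functional_bound.
Qed.

(** Lifting [b] to [(b, b)] annihilates the bridge term. *)
Lemma bridge_isometry1 : @quantum_isometry R bridge_space Un_space (fun p => p.1).
Proof.
apply: quantum_isometry_of_lift => /=.
- exact: (usc_morphism (usc_fst _ _)).
- by move=> b; exists (b, 0).
- by move=> p [s1 _]; split => //; rewrite /bridge_lip !le_max lexx.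
- move=> b sb; have sv := sa_val sb.
  have db : bridge_dom (b, val b) by split => //; exact: fr_dom_in sv (inU b).
  exists (b, val b); split => //.
  have L0 := frobenius_rieffel_lip_ge0 n (val b).
  apply/(bridge_lip_le db L0); split => //=; last by rewrite subrr cnorm0 mulr_ge0// ltW.
  by apply/(fr_lip_le _ db.2)/(frobenius_rieffel_lip_le sv (inU b) L0).
Qed.

Let condexp_elt a : Un := SubalgElt (introT (asboolP _) (condexp_in (E_cond n) a)).

(** Lifting [a] to [(E n a, a)] does not increase the seminorm: the weight [tail n] of the bridge
    term is the constant in [cnorm (a - E n a) <= fr_lip a * tail n]. *)
Lemma bridge_isometry2 : @quantum_isometry R bridge_space A_space (fun p => p.2).
Proof.
apply: quantum_isometry_of_lift => /=.
- exact: (usc_morphism (usc_snd _ _)).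
- by move=> a; exists (0, a).
- by move=> p [_ d2]; split => //; rewrite /bridge_lip !le_max lexx orbT.
- move=> a da; have L0 := fr_lip_ge0 da; have [sa _] := da.
  have sE : selfadjoint (condexp_elt a).
    apply: val_inj; change (star (E n a) = E n a).
    by rewrite -(condexp_star tau_ge0 tau_faithful (E_cond n) (tauE n)) sa.
  have da' : bridge_dom (condexp_elt a, a) by split.
  exists (condexp_elt a, a); split => //.
  have aL := proj1 (fr_lip_le _ da) (lexx _).
  apply/(bridge_lip_le da' L0); split => //=; last by rewrite cnorm_distC fr_tail.
  apply/(frobenius_rieffel_lip_le (sa_val sE) (inU (condexp_elt a)) L0) => m.
  exact: le_trans (fr_seminorm_condexp _ _ _) (aL m).
Qed.

Lemma bridge_extent_le :
  (@tunnel_extent R Un_space A_space bridge_space (fun p => p.1) (fun p => p.2)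
     <= (tail n)%:E)%E.
Proof.
have t0 := ltW (tail_gt0 n).
have p12 p : bridge_dom p -> bridge_lip p <= 1 -> cnorm (val p.1 - p.2) <= tail n.
  by move=> dp /(bridge_lip_le dp ler01)[_ _]; rewrite mul1r.
rewrite ge_max; apply/andP; split; apply: hausdorff_states_le => //.
- exact: bridge_isometry1.
- move=> mu Smu; exists (mu \o (fun b : Un => (b, val b) : direct_sum Un A)).
    exact: state_comp.
  (* The two arguments of [mu] differ by [(0, p.2 - p.1)], whose norm the bridge term controls. *)
  move=> p dp Lp /=; rewrite -(stateB _ _ Smu).
  rewrite (le_trans (state_normc_le _ Smu))// (le_trans _ (p12 p dp Lp))//.
  by rewrite cnorm_direct_sum /= subrr cnorm0 ge_max cnorm_ge0 cnorm_distC lexx.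
- exact: bridge_isometry2.
- move=> mu Smu; have [mulin mupos mu1] := Smu.
  exists (mu \o (fun a : A => (condexp_elt a, a) : direct_sum Un A)); last first.
    move=> p dp Lp /=; rewrite -(stateB _ _ Smu).
    rewrite (le_trans (state_normc_le _ Smu))// (le_trans _ (p12 p dp Lp))//.
    rewrite cnorm_direct_sum /= subrr cnorm0 ge_max cnorm_ge0 andbT.
    (* As [E n] fixes [p.1], the difference is the image of [p.1 - p.2] under a contraction. *)
    have -> : cnorm (p.1 - condexp_elt p.2) = cnorm (E n (val p.1 - p.2)).
      by rewrite (condexpB (E_cond n)) (condexp_id (E_cond n) (inU p.1)).
    exact: (condexp_le (E_cond n)).
  split=> /= [z a b|a|].
  + rewrite -mulin; congr (mu _); congr pair; apply: val_inj => /=.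
    by rewrite (condexpD (E_cond n)) (condexpZ (E_cond n)).
  (* Positivity is checked on each summand: [(0, a^* a)] is of the form [q^* q], and
     [(E n (a^* a), 0)] is handled by the positive functional [x |-> mu (x, 0)] on [U n]. *)
  + have -> : ((condexp_elt (star a * a), star a * a) : direct_sum Un A) =
        (condexp_elt (star a * a), 0) + (0, star a * a).
      by congr pair; rewrite ?addr0 ?add0r.
    rewrite (stateD _ _ Smu) addr_ge0//; last first.
      have := mupos (0, a); congr (0 <= mu _); congr pair => /=.
      by rewrite mulr0.
    have flin : scalar (fun x : Un => mu (x, 0)).
      move=> z x y; rewrite -mulin; congr (mu _); congr pair.
      by rewrite /= scaler0 addr0.
    pose f : {scalar Un} :=
      HB.pack (fun x : Un => mu (x, 0)) (GRing.isLinear.Build R[i] Un R[i] _ _ flin).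
    apply: (condexp_abs_positive tau_ge0 tau1 tau_faithful (U_fin n) (E_cond n)
      (tauE n) (f := f) (x := condexp_elt (star a * a)) (a := a)) => // y.
    have := mupos (y, 0); congr (0 <= mu _); congr pair => /=.
    by rewrite mulr0.
  + rewrite -[RHS]mu1; congr (mu _); congr pair; apply: val_inj => /=.
    by rewrite (condexp_id (E_cond n))//; exact: subalg1.
Qed.

Theorem fr_dual_propinquity_le :
  (dual_propinquity_SL Un_space A_space <= (tail n)%:E)%E.
Proof.
apply: le_trans bridge_extent_le; apply: ereal_inf_lbound.
have [Dq Dsl] := bridge_qcms.
exists bridge_space, (fun p => p.1), (fun p => p.2); split => //.
by split; [|exact: bridge_isometry1|exact: bridge_isometry2].
Qed.

End Tunnel.

End FrobeniusRieffelTower.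

(** * Tails of the series and the limit theorem *)

(** Real representatives of the tails. Positivity, which allows division by [tail n] in the bridge
    term, comes from [beta n <= tail n]. *)
Lemma summable_tail (R : realType) (beta : nat -> R) :
  (forall n, 0 < beta n) -> cvgn (series beta) -> exists tail : nat -> R,
  [/\ forall n, (\sum_(n <= j <oo) (beta j)%:E)%E = (tail n)%:E,
      forall n, 0 < tail n,
      forall n N, \sum_(n <= j < N) beta j <= tail n
    & tail n @[n --> \oo] --> 0].
Proof.
move=> b0 cb.
have bE0 n k : (n <= k)%N -> (0 <= (beta k)%:E)%E by rewrite lee_fin ltW.
have ub n N : ((\sum_(n <= j < N) beta j)%:E <= \sum_(n <= j <oo) (beta j)%:E)%E.
  by rewrite -sumEFin; apply: nneseries_lim_ge => k nk _; exact: bE0 nk.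
have fin0 : (\sum_(0 <= j <oo) (beta j)%:E < +oo)%E.
  have -> : (\sum_(0 <= j <oo) (beta j)%:E)%E = (limn (series beta))%:E.
    rewrite -EFin_lim//; congr (limn _); apply/funext => N /=.
    by rewrite /series /= sumEFin.
  exact: ltry.
have fin n : (\sum_(n <= j <oo) (beta j)%:E)%E \is a fin_num.
  rewrite ge0_fin_numE; last by apply: nneseries_ge0 => k nk _; exact: bE0 nk.
  apply: le_lt_trans fin0; rewrite (@nneseries_split _ (fun j => (beta j)%:E) 0 n).
    by rewrite add0n leeDr// sume_ge0// => k _; exact: bE0 (leq0n k).
  by move=> k; exact: bE0.
pose tl n := fine (\sum_(n <= j <oo) (beta j)%:E)%E.
exists tl.
have fE n : (\sum_(n <= j <oo) (beta j)%:E)%E =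
  (tl n)%:E by rewrite fineK.
split=> // [n|n N|].
- rewrite -lte_fin -fE; apply: lt_le_trans (ub n n.+1).
  by rewrite big_nat1 lte_fin.
- by rewrite -lee_fin -fE.
- apply: (@fine_cvg _ _ _ _ _ 0).
  by apply: (@nneseries_tail_cvg _ _ xpredT) => // k _; exact: bE0 (leq0n k).
Qed.

Theorem theorem3p4 (R : realType) (A : cstarType R) (tau : A -> R[i])
  (U : nat -> cstar_subalgebra A) (E : nat -> A -> A) (beta kappa : nat -> R)
  (tau_trace : tracial_state tau) (tau_faithful : faithful tau)
  (U_mono : forall n, U n `<=` U n.+1)
  (U_fin : forall n, finite_dimensional (U n))
  (U_0 : U 0%N = [set z *: (1 : A) | z in [set: R[i]]] :> set A)
  (U_dense : closure ((\bigcup_n U n) : set (normed A)) = setT)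
  (beta_gt0 : forall n, 0 < beta n) (beta_sum : cvgn (series beta))
  (E_cond : forall n, conditional_expectation (U n) (E n))
  (E_faithful : forall n, faithful (E n))
  (E_tau : forall n, tau \o E n = tau)
  (kappa_gt0 : forall n, 0 < kappa n)
  (kappa_le : forall n a, subalg_set (U n.+1) a ->
     kappa n * cnorm a <= frobenius_rieffel_norm (E n) a) :
  (forall n, strongly_leibniz_qcms (frobenius_rieffel_space E kappa beta U n)) /\
  exists (dom : set A) (L : A -> R),
    [/\ strongly_leibniz_qcms (QuantumPair dom L),
        forall n, (dual_propinquity_SL (frobenius_rieffel_space E kappa beta U n)
                     (QuantumPair dom L)
                   <= 4%:E * \sum_(n <= j <oo) (beta j)%:E)%E
      & dual_propinquity_SL (frobenius_rieffel_space E kappa beta U n)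
          (QuantumPair dom L) @[n --> \oo] --> 0%E].
Proof.
have [tau_state _] := tau_trace.
have [f ftau [f_ge0 f1]] := state_scalar tau_state; subst tau.
have [tail [tailE tail_gt0 tail_ub tail_cvg]] := summable_tail beta_gt0 beta_sum.
have tail_small (e : R) : 0 < e -> exists N, tail N < e.
  move=> e0; move/cvgrPdist_lt: tail_cvg => /(_ _ e0)[N _ /(_ N (leqnn N))].
  by rewrite /= sub0r normrN gtr0_norm//; exists N.
have le_tail n : (dual_propinquity_SL (frobenius_rieffel_space E kappa beta U n)
    (QuantumPair (fr_dom E beta kappa) (fr_lip E beta kappa)) <= (tail n)%:E)%E.
  exact: (fr_dual_propinquity_le f_ge0 f1).
split; first by move=> n; exact: (fr_space_qcms f_ge0 f1 _ _ _ _ _ _ _ _ _ _ tail_gt0).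
exists (fr_dom E beta kappa), (fr_lip E beta kappa); split.
- exact: (fr_limit_qcms f_ge0 f1 _ _ _ _ _ _ _ _ _ _ tail_gt0).
(* The tunnel gives the bound with constant 1, and [1 <= 4]. *)
- move=> n; apply: le_trans (le_tail n) _; rewrite tailE -EFinM lee_fin.
  by rewrite ler_peMl ?(ltW (tail_gt0 n))// ler1n.
- apply: (@squeeze_cvge _ _ _ _ (cst 0%E) _ (fun n => (tail n)%:E)).
  + apply: nearW => n; rewrite le_tail andbT; apply: dual_propinquity_SL_ge0.
    (* The trace restricted to [U n] is the state required for nonnegativity. *)
    exists (f \o (val : subalg_type (U n) -> A)).
    by apply: state_comp tau_state; [exact: (usc_morphism (usc_val _))|].
  + exact: cvg_cst.
  + by apply/fine_cvgP; split => //; exact: nearW.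
Qed.
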